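(* Let $n\ge 2$, $\alpha>-1$ and $Q\in L^\infty_{\rm loc}(\mathbb{R}^n)$. Let $u$ be a radial normal solution of $(-\Delta)^{n/2}u=|x|^{n\alpha}Qe^{nu}$ in $\mathbb{R}^n$ with $\int_{\mathbb{R}^n}|x|^{n\alpha}|Q|e^{nu}\,dx<\infty$, and let $\Lambda:=\int_{\mathbb{R}^n}|x|^{n\alpha}e^{nu(x)}\,dx$. If $Q\ge 1$, then $$\Lambda\le \Lambda_1(1+\alpha).$$ Moreover, equality holds if and only if $Q\equiv 1$.
   Context: Notation: $\gamma_n:=\frac{(n-1)!}{2}|\mathbb{S}^n|$ and $\Lambda_1:=2\gamma_n=(n-1)!\,|\mathbb{S}^n|$, where $|\mathbb{S}^n|$ is the surface measure of the unit sphere in $\mathbb{R}^{n+1}$. A normal solution of $(-\Delta)^{n/2}u=|x|^{n\alpha}Qe^{nu}$ with $|x|^{n\alpha}Qe^{nu}\in L^1(\mathbb{R}^n)$ is a function $u$ satisfying, for some $c\in\mathbb{R}$, the integral equation $$u(x)=\frac{1}{\gamma_n}\int_{\mathbb{R}^n}\log\left(\frac{1+|y|}{|x-y|}\right)|y|^{n\alpha}Q(y)e^{nu(y)}\,dy+c .$$ For $Q\in L^\infty_{\rm loc}$ and $\alpha>-1$ such $u$ is continuous on $\mathbb{R}^n$ and $C^1$ on $\mathbb{R}^n\setminus\{0\}$. Inequalities and identities for $Q$ are understood almost everywhere. *)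

(* Defs.v *)
From HB Require Import structures.
From mathcomp Require Import all_boot all_order all_algebra.
From mathcomp Require Import all_classical all_reals all_analysis.

Set Implicit Arguments.
Unset Strict Implicit.
Unset Printing Implicit Defensive.
Import Order.TTheory GRing.Theory Num.Theory.
Import numFieldNormedType.Exports.

Local Open Scope classical_set_scope.
Local Open Scope ring_scope.

(* R^n is [n.-tuple R], whose measurable sets are the Borel sets: the
   sigma-algebra is generated by the coordinates. *)

Section lebesgue_cons.
Context (R : realType) (n : nat).

Definition tuple_cons (p : measurableTypeR R * n.-tuple R) : n.+1.-tuple R :=
  [tuple of p.1 :: p.2].

Definition tuple_uncons (t : n.+1.-tuple R) : measurableTypeR R * n.-tuple R :=
  (thead t, [tuple of behead t]).

Lemma measurable_tuple_cons :
  measurable_fun [set: measurableTypeR R * n.-tuple R] tuple_cons.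
Proof. exact: measurable_cons. Qed.

Lemma measurable_tuple_uncons :
  measurable_fun [set: n.+1.-tuple R] tuple_uncons.
Proof.
apply/measurable_fun_pairP; split.
  exact: (measurable_tnth ord0).
exact: measurable_behead.
Qed.

Lemma tuple_consK : cancel tuple_cons tuple_uncons.
Proof. by case=> x t; congr pair; exact/val_inj. Qed.

Lemma tuple_unconsK : cancel tuple_uncons tuple_cons.
Proof. by move=> t; rewrite [RHS]tuple_eta. Qed.

Variable mu : {sigma_finite_measure set (n.-tuple R) -> \bar R}.

Definition lebesgue_cons : set (n.+1.-tuple R) -> \bar R :=
  pushforward (lebesgue_measure \x mu)%E tuple_cons.

Let lebesgue_cons0 : lebesgue_cons set0 = 0%E.
Proof. by rewrite /lebesgue_cons /pushforward preimage_set0 measure0. Qed.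

Let lebesgue_cons_ge0 A : (0 <= lebesgue_cons A)%E.
Proof. by rewrite /lebesgue_cons /pushforward measure_ge0. Qed.

Let lebesgue_cons_sigma_additive : semi_sigma_additive lebesgue_cons.
Proof.
pose m := measure_function_pushforward__canonical__measure_function_Measure
  (lebesgue_measure \x mu)%E measurable_tuple_cons.
exact: (@measure_semi_sigma_additive _ _ _ m).
Qed.

HB.instance Definition _ := isMeasure.Build _ _ _ lebesgue_cons
  lebesgue_cons0 lebesgue_cons_ge0 lebesgue_cons_sigma_additive.

Let lebesgue_cons_sigma_finite : sigma_finite setT lebesgue_cons.
Proof.
have /sigma_finiteP[F [TF ndF Foo]] := sigma_finiteT (@lebesgue_measure R).
have /sigma_finiteP[G [TG ndG Goo]] := sigma_finiteT mu.
exists (fun k => tuple_uncons @^-1` (F k `*` G k)).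
  rewrite -preimage_bigcup (_ : \bigcup_k _ = setT) ?preimage_setT//.
  apply/seteqP; split => // -[x t] _.
  have [i _ Fix] : (\bigcup_i F i) x by rewrite -TF.
  have [j _ Gjt] : (\bigcup_i G i) t by rewrite -TG.
  exists (maxn i j) => //; split => /=.
    by move: x Fix; exact/subsetPset/ndF/leq_maxl.
  by move: t Gjt; exact/subsetPset/ndG/leq_maxr.
move=> k; have [mF muF] := Foo k; have [mG muG] := Goo k; split.
  rewrite -[X in measurable X]setTI.
  by apply: measurable_tuple_uncons => //; exact: measurableX.
rewrite /lebesgue_cons /pushforward -comp_preimage.
rewrite (_ : _ \o _ = id) ?preimage_id; last first.
  by apply/funext => p; exact: tuple_consK.
by rewrite product_measure1E// lte_mul_pinfty// ge0_fin_numE.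
Qed.

HB.instance Definition _ := Measure_isSigmaFinite.Build _ _ _ lebesgue_cons
  lebesgue_cons_sigma_finite.

End lebesgue_cons.

Fixpoint lebesgue_tuple (R : realType) (n : nat) :
    {sigma_finite_measure set (n.-tuple R) -> \bar R} :=
  match n with
  | 0 => \d_[tuple]
  | m.+1 => lebesgue_cons (lebesgue_tuple R m)
  end.

Lemma lebesgue_tuple_box (R : realType) (n : nat) (A : 'I_n -> set R) :
  (forall i, measurable (A i)) ->
  lebesgue_tuple R n [set x | forall i, A i (tnth x i)] =
  (\prod_(i < n) lebesgue_measure (A i))%E.
Proof.
elim: n A => [|n IH] A mA.
  rewrite big_ord0 /= diracE (_ : _ \in _) //.
  by rewrite inE => -[].
rewrite big_ord_recl -(IH (fun i => A (lift ord0 i)))//.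
rewrite /= /lebesgue_cons /pushforward.
rewrite -product_measure1E.
- congr (product_measure1 _ _ _); apply/seteqP; split => -[x t] /=.
    move=> h; split; first exact: (h ord0).
    by move=> i /=; have := h (lift ord0 i); rewrite tnthS.
  move=> [h0 h] i; case: (unliftP ord0 i) => [j ->|->//].
  by rewrite tnthS; exact: h.
- exact: mA.
- rewrite (_ : [set _ | _] = \bigcap_(i in setT)
    ((fun x : n.-tuple R => tnth x i) @^-1` A (lift ord0 i))).
    apply: fin_bigcap_measurable => // i _.
    by rewrite -[X in measurable X]setTI; exact: measurable_tnth.
  by apply/seteqP; split => [x Ax i _|x Ax i]; [exact: Ax|exact: (Ax i)].
Qed.

Section euclidean.
Context (R : realType) (n : nat).
Implicit Types x y : n.-tuple R.

Definition enorm x : R := Num.sqrt (\sum_(i < n) tnth x i ^+ 2).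

Definition tuple_sub x y : n.-tuple R := [tuple tnth x i - tnth y i | i < n].

Definition tuple_scale (a : R) x : n.-tuple R := [tuple a * tnth x i | i < n].

Definition unit_sphere : set (n.-tuple R) := [set x | enorm x = 1].

Definition unit_cone (A : set (n.-tuple R)) : set (n.-tuple R) :=
  [set x | exists r theta, [/\ 0 < r <= 1, A theta & x = tuple_scale r theta]].

(* The surface measure of polar coordinates: |A| is n times the Lebesgue measure
   of the cone over A, since the part of that cone at radius r has measure
   r^(n-1) |A| and the integral of r^(n-1) over ]0, 1] is 1/n. *)
Definition surface_measure (A : set (n.-tuple R)) : \bar R :=
  (n%:R%:E * lebesgue_tuple R n (unit_cone (A `&` unit_sphere)))%E.

End euclidean.

(* |S^n|, for the unit sphere S^n of R^(n+1). *)
Definition sphere_area (R : realType) (n : nat) : R :=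
  fine (surface_measure (@unit_sphere R n.+1)).

Definition gamma_ (R : realType) (n : nat) : R :=
  (n.-1)`!%:R / 2 * sphere_area R n.

Definition Lambda1 (R : realType) (n : nat) : R := 2 * gamma_ R n.

Section normal_solution.
Context (R : realType) (n : nat).
Implicit Types Q u : n.-tuple R -> R.

(* Essentially bounded on every ball, equivalently on every compact set. *)
Definition locally_Linfty Q : Prop :=
  measurable_fun setT Q /\
  forall r : R,
    (Lnorm (lebesgue_tuple R n) +oo
       (fun x => (Q x * \1_[set y | enorm y <= r] x)%:E) < +oo)%E.

Definition radial u : Prop := exists v : R -> R, forall x, u x = v (enorm x).

(* [ln 0 = 0] and division by 0 only affect the single point y = x, and the value
   of [powR] at 0 only the point y = 0; both are negligible. *)
Definition log_kernel (x y : n.-tuple R) : R :=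
  ln ((1 + enorm y) / enorm (tuple_sub x y)).

Definition normal_solution (alpha : R) Q u : Prop :=
  let mu := lebesgue_tuple R n in
  let f y := enorm y `^ (n%:R * alpha) * Q y * expR (n%:R * u y) in
  mu.-integrable setT (EFin \o f) /\
  exists c : R, forall x,
    mu.-integrable setT (fun y => (log_kernel x y * f y)%:E) /\
    u x = (gamma_ R n)^-1 * (\int[mu]_y (log_kernel x y * f y)) + c.

End normal_solution.

(* Main.v *)
Require Import Defs.
From HB Require Import structures.
From mathcomp Require Import all_boot all_order all_algebra.
From mathcomp Require Import all_classical all_reals all_analysis.
From mathcomp Require Import measurable_realfun.
From mathcomp Require Import ring lra.

Set Implicit Arguments.
Unset Strict Implicit.
Unset Printing Implicit Defensive.
Import Order.TTheory GRing.Theory Num.Theory.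
Import numFieldNormedType.Exports.

Local Open Scope classical_set_scope.
Local Open Scope ring_scope.

(** Write w = |x|^(n alpha) e^(n u) and f = Q w, so that f >= w, and let L be the
    integral of w. If u is differentiable, then
    r u'(r) = - (1 / gamma) \int K(x, y) f(y) dy with
    K(x, y) = x . (x - y) / |x - y|^2, and integrating r w'(r) by parts gives
    Pohozaev's identity
      gamma (1 + alpha) L = \int \int K(x, y) w(x) f(y) dy dx.
    Since K(x, y) + K(y, x) = 1, replacing f by w on the right leaves L^2 / 2.
    The functions are radial, so K may be averaged over rotations of x, and the
    average is nonnegative because ln |x - y| is subharmonic in x: its means over
    circles that are centred at the origin grow with the radius. Hence
    gamma (1 + alpha) L >= L^2 / 2, which is the claim, and equality forces f = w
    because the average is positive when |x| > |y|.

    The proof below avoids derivatives and boundary terms by working with finite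
    dilations of ratio e^h and letting h tend to 0 at the end.

    The identity becomes an inequality for every real h, dilation_le: the mass of
    w is unchanged by the substitution x -> e^(-h) x, and e^z >= 1 + z. The two
    signs of h give the two bounds that the case Q = 1 needs.

    Averages are taken over the circle of radius r in the plane of the first two
    coordinates (great_circle). A radial u is constant there, so it is the
    potential of f for the averaged kernel (great_circle_potential), and the
    averaged kernel has a closed form by Jensen's formula
    (circle_integral_ln_sq_dist1, circle_integral_log_kernel). The mean of
    ln |x - y| over the circle is half the logarithm of the larger root of an
    explicit quadratic. From this equation follow that the mean is nondecreasing
    in ln r with slope at most 1 (log_mean_diff_bound), that the slope is at least
    1/2 for r > |y| (log_mean_diff_half), and that the mean is symmetric in r and
    |y| once the ratio |y'| / |y| is fixed, where y' is the projection of y to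
    the plane of the circle.

    That ratio depends only on the direction of y, which is independent of |y|
    under the Lebesgue measure. So |x| and |y| may be exchanged in double
    integrals (radius_swap), and this takes the place of K(x, y) + K(y, x) = 1:
    pairing_cvg gives the limit L^2 / 2. The bound, the case Q = 1 and the case of
    equality are mass_le, mass_ge and mass_eq_rigidity. *)

(** * Integration under affine maps of the line and dilations of the space *)

Section affine.
Context {R : realType}.

Lemma lebesgue_measure_affine (k b : R) (A : set R) : 0 < k -> measurable A ->
  pushforward lebesgue_measure (fun x => k * x + b : measurableTypeR R) A =
  (k^-1%:E * lebesgue_measure A)%E.
Proof.
move=> k0 mA.
have mf : measurable_fun [set: measurableTypeR R] (fun x => k * x + b : measurableTypeR R).
  by apply: measurable_funD => //; exact: measurable_funM.
pose m0 := measure_function_pushforward__canonical__measure_function_Measure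
  (@lebesgue_measure R) mf.
have -> : lebesgue_measure A = mscale (NngNum (ltW k0)) m0 A.
  apply: (@lebesgue_measure_unique R (mscale (NngNum (ltW k0)) m0)) => //.
  move=> _ [[x y]] _ <-.
  have -> : lebesgue_measure (`]x, y]%classic : set R) =
            (k%:E * lebesgue_measure (`]((x - b) / k)%R, ((y - b) / k)%R]%classic : set R))%E.
    rewrite !lebesgue_measure_itv/= !lte_fin ltr_pM2r ?invr_gt0// ltrD2r.
    case: ifPn => _; last by rewrite mule0.
    rewrite -!EFinD -EFinM; congr (_%:E); field; exact: lt0r_neq0.
  rewrite /mscale/=; congr (_ * _)%E; rewrite /pushforward.
  congr (lebesgue_measure _); apply/seteqP; split => z /=;
    rewrite !in_itv/= ler_pdivlMr// ltr_pdivrMr// ltrBlDr lerBrDr;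
    by rewrite (mulrC z).
rewrite /mscale/= muleA -EFinM mulVf ?mul1e// gt_eqF//.
Qed.

Lemma ge0_integral_affine (k b : R) (f : R -> \bar R) : 0 < k ->
  measurable_fun [set: R] f -> (forall x, 0 <= f x)%E ->
  (\int[lebesgue_measure]_x f (k * x + b)%R =
   k^-1%:E * \int[lebesgue_measure]_x f x)%E.
Proof.
move=> k0 mf f0.
pose g (x : measurableTypeR R) : measurableTypeR R := k * x + b.
have mg : measurable_fun [set: measurableTypeR R] g.
  by apply: measurable_funD => //; exact: measurable_funM.
have k'0 : 0 <= k^-1 by rewrite invr_ge0 ltW.
rewrite -[RHS](@ge0_integral_mscale _ _ _ lebesgue_measure _ measurableT (NngNum k'0))//.
transitivity (\int[pushforward lebesgue_measure g]_x f x)%E.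
  by rewrite (@ge0_integral_pushforward _ _ _ _ _ _ mg).
apply: (eq_measure_integral (mscale (NngNum k'0) (@lebesgue_measure R))) => A mA _.
exact: lebesgue_measure_affine.
Qed.

End affine.

Section tuple_integration.
Context {R : realType}.

Lemma measurable_tuple_scale n (s : R) :
  measurable_fun [set: n.-tuple R] (@tuple_scale R n s).
Proof.
apply/measurable_fun_tnthP => i.
rewrite (_ : _ \o _ = fun x : n.-tuple R => s * tnth x i); last first.
  by apply/funext => x /=; rewrite tnth_mktuple.
by apply: measurable_funM => //; exact: measurable_tnth.
Qed.

Lemma tuple_scale_cons n (s x : R) (t : n.-tuple R) :
  tuple_scale s (tuple_cons (x, t)) = tuple_cons (s * x, tuple_scale s t).
Proof.
apply: eq_from_tnth => i; rewrite tnth_mktuple /tuple_cons/=.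
case: (unliftP ord0 i) => [j ->|->]; last by rewrite !tnth0.
by rewrite !tnthS tnth_mktuple.
Qed.

Lemma ge0_integral_tuple_cons n (f : n.+1.-tuple R -> \bar R) :
  measurable_fun setT f -> (forall t, 0 <= f t)%E ->
  (\int[lebesgue_tuple R n.+1]_t f t =
   \int[lebesgue_measure]_x \int[lebesgue_tuple R n]_t f (tuple_cons (x, t)))%E.
Proof.
move=> mf f0.
have mc := @measurable_tuple_cons R n.
rewrite -(@fubini_tonelli1 _ _ _ _ _ _ _ (fun p => f (tuple_cons p)))//; last first.
  exact: measurableT_comp.
pose m := measure_function_pushforward__canonical__measure_function_Measure
  (lebesgue_measure \x lebesgue_tuple R n)%E mc.
rewrite (@eq_measure_integral _ _ _ _ m)//.
exact: (@ge0_integral_pushforward _ _ _ _ _ _ mc).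
Qed.

(** By induction on the dimension: a dilation of the space dilates the first
coordinate and the remaining ones separately, so Tonelli's theorem reduces the
claim to the one-dimensional change of variables. *)
Lemma ge0_integral_tuple_scale n (s : R) (f : n.-tuple R -> \bar R) : 0 < s ->
  measurable_fun setT f -> (forall t, 0 <= f t)%E ->
  (\int[lebesgue_tuple R n]_t f (tuple_scale s t) =
   (s ^- n)%:E * \int[lebesgue_tuple R n]_t f t)%E.
Proof.
move=> s0; elim: n f => [|n IH] f mf f0.
  rewrite expr0 invr1 mul1e; apply: eq_integral => t _.
  by rewrite [tuple_scale _ _]tuple0 [t]tuple0.
rewrite !ge0_integral_tuple_cons//; last first.
  by apply: measurableT_comp => //; exact: measurable_tuple_scale.
have mfc : measurable_fun setT (fun p => f (@tuple_cons R n p)).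
  by apply: measurableT_comp => //; exact: measurable_tuple_cons.
pose G x := (\int[lebesgue_tuple R n]_t f (tuple_cons (x, t)))%E.
have mG : measurable_fun setT G.
  exact: (@measurable_fun_fubini_tonelli_F _ _ _ _ _ _ (fun p => f (@tuple_cons R n p))).
have G0 x : (0 <= G x)%E by apply: integral_ge0.
have sn0 : 0 <= s ^- n by rewrite invr_ge0 exprn_ge0// ltW.
transitivity (\int[lebesgue_measure]_x ((s ^- n)%:E * G (s * x + 0)%R))%E.
  apply: eq_integral => x _; rewrite addr0 /G.
  rewrite -IH//; last by apply: measurableT_comp mfc _; exact: measurable_pair1.
  by apply: eq_integral => t _; rewrite tuple_scale_cons.
rewrite ge0_integralZl_EFin//; last first.
  apply: measurableT_comp => //.
  by apply: measurable_funD => //; exact: measurable_funM.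
rewrite ge0_integral_affine// muleA -EFinM; congr (_%:E * _)%E.
by rewrite exprS invfM mulrC.
Qed.

Lemma lebesgue_tuple_scale n (s : R) (A : set (n.-tuple R)) : 0 < s ->
  measurable A ->
  (lebesgue_tuple R n (tuple_scale s @^-1` A) =
   (s ^- n)%:E * lebesgue_tuple R n A)%E.
Proof.
move=> s0 mA; have mA' : measurable (tuple_scale s @^-1` A).
  by rewrite -[X in measurable X]setTI; exact: measurable_tuple_scale.
rewrite -(setIT A) preimage_setI preimage_setT -!integral_indic//.
rewrite -ge0_integral_tuple_scale//.
by apply/measurable_EFinP; exact: measurable_indic.
Qed.

End tuple_integration.

(** * The Euclidean norm and its balls *)

Section euclidean_norm.
Context {R : realType}.

Lemma measurable_enorm n : measurable_fun [set: n.-tuple R] (@enorm R n).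
Proof.
apply: (@measurableT_comp _ _ _ _ _ _ (@Num.sqrt R)).
  exact: continuous_measurable_fun (@sqrt_continuous R).
by apply: measurable_sum => i; apply: measurable_funX; exact: measurable_tnth.
Qed.

Lemma measurableT_enorm d (S : measurableType d) n (f : S -> n.-tuple R) :
  measurable_fun setT f -> measurable_fun setT (fun x => enorm (f x)).
Proof. by move=> mf; exact: (measurableT_comp (@measurable_enorm n)). Qed.

Lemma measurable_preimage_enorm n (A : set R) : measurable A ->
  measurable [set x : n.-tuple R | A (enorm x)].
Proof. by move=> mA; rewrite -[X in measurable X]setTI; exact: measurable_enorm. Qed.

Lemma enorm_ge0 n (x : n.-tuple R) : 0 <= enorm x.
Proof. exact: sqrtr_ge0. Qed.

Lemma sqr_enorm n (x : n.-tuple R) : enorm x ^+ 2 = \sum_(i < n) tnth x i ^+ 2.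
Proof. by rewrite sqr_sqrtr// sumr_ge0// => i _; rewrite sqr_ge0. Qed.

Lemma enorm_scale n (s : R) (x : n.-tuple R) : 0 <= s ->
  enorm (tuple_scale s x) = s * enorm x.
Proof.
move=> s0; rewrite /enorm; under eq_bigr do rewrite tnth_mktuple exprMn.
by rewrite -mulr_sumr sqrtrM ?sqr_ge0// sqrtr_sqr ger0_norm.
Qed.

Lemma tnth_le_enorm n (x : n.-tuple R) i : `|tnth x i| <= enorm x.
Proof.
rewrite -sqrtr_sqr; apply: ler_wsqrtr; rewrite (bigD1 i)//= lerDl.
by apply: sumr_ge0 => j _; rewrite sqr_ge0.
Qed.

Lemma measurable_enorm_lt n (a : R) : measurable [set x : n.-tuple R | enorm x < a].
Proof.
rewrite [X in measurable X](_ : _ = @enorm R n @^-1` `]-oo, a[%classic); last first.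
  by apply/seteqP; split => x /=; rewrite in_itv.
by rewrite -[X in measurable X]setTI; exact: measurable_enorm.
Qed.

Lemma lebesgue_tuple_cube n (a : R) : 0 <= a ->
  lebesgue_tuple R n [set x | forall i, tnth x i \in `]-a, a[] = ((2 * a) ^+ n)%:E.
Proof.
move=> a0.
rewrite (lebesgue_tuple_box (A := fun=> `]-a, a[%classic))//.
rewrite (eq_bigr (fun=> (2 * a)%:E)); last first.
  move=> i _; rewrite lebesgue_measure_itv/= lte_fin.
  case: ifPn => [_|]; first by rewrite -EFinB; congr (_%:E); ring.
  rewrite -leNgt => h; have -> : a = 0 by lra.
  by rewrite mulr0.
by rewrite prodEFin prodr_const card_ord.
Qed.

Lemma measurable_cube n (a : R) :
  measurable [set x : n.-tuple R | forall i, tnth x i \in `]-a, a[].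
Proof.
rewrite (_ : [set _ | _] = \bigcap_(i in setT)
  ((fun x : n.-tuple R => tnth x i) @^-1` `]-a, a[%classic)).
  apply: fin_bigcap_measurable => // i _.
  by rewrite -[X in measurable X]setTI; exact: measurable_tnth.
by apply/seteqP; split => [x Ax i _|x Ax i]; [exact: Ax|exact: (Ax i)].
Qed.

Lemma lebesgue_tuple_ball_lty n (a : R) :
  (lebesgue_tuple R n [set x | (enorm x < a)%R] < +oo)%E.
Proof.
have [a0|a0] := ltP a 0.
  rewrite (_ : [set _ | _] = set0) ?measure0//.
  by apply/seteqP; split => x //= xa; have := enorm_ge0 x; lra.
apply: le_lt_trans (ltry ((2 * a) ^+ n)).
rewrite -lebesgue_tuple_cube//; apply: le_measure; rewrite ?inE.
- exact: measurable_enorm_lt.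
- exact: measurable_cube.
move=> x /= xa i; rewrite in_itv/= -ltr_norml.
exact: le_lt_trans (tnth_le_enorm _ _) xa.
Qed.

(** The cube with half-side a / (n + 1) lies in the ball of radius a, because n
squares of that size add up to less than a^2. *)
Lemma lebesgue_tuple_ball_gt0 n (a : R) : 0 < a ->
  (0 < lebesgue_tuple R n [set x | (enorm x < a)%R])%E.
Proof.
move=> a0; pose b := a / n.+1%:R.
have b0 : 0 < b by rewrite divr_gt0// ltr0n.
apply: (@lt_le_trans _ _ ((2 * b) ^+ n)%:E).
  by rewrite lte_fin exprn_gt0// mulr_gt0.
rewrite -(lebesgue_tuple_cube _ (ltW b0)); apply: le_measure; rewrite ?inE.
- exact: measurable_cube.
- exact: measurable_enorm_lt.
move=> x /= xb; rewrite -(@ltr_pXn2r _ 2)// ?nnegrE ?enorm_ge0 ?ltW//.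
rewrite sqr_enorm; apply: (@le_lt_trans _ _ (\sum_(i < n) b ^+ 2)).
  apply: ler_sum => i _; have := xb i; rewrite in_itv/= => /andP[h1 h2].
  by rewrite -real_normK ?num_real// lerXn2r// ?nnegrE ?(ltW b0)// ler_norml !ltW.
rewrite sumr_const card_ord -[_ *+ n]mulr_natr /b expr_div_n.
rewrite -mulrA gtr_pMr ?exprn_gt0// mulrC -natrX ltr_pdivrMr ?ltr0n ?expn_gt0//.
by rewrite mul1r ltr_nat -mulnn (leq_trans (ltnSn n))// leq_pmulr.
Qed.

End euclidean_norm.

(** * Polar coordinates *)

Lemma ge0_integral_mrestr (R : realType) d (S : measurableType d) (m : {measure set S -> \bar R})
    (D : set S) (mD : measurable D) (f : S -> \bar R) :
  measurable_fun setT f -> (forall x, 0 <= f x)%E ->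
  (\int[mrestr m mD]_x f x = \int[m]_(x in D) f x)%E.
Proof.
move=> mf f0.
rewrite (@ge0_negligible_integral _ _ _ (mrestr m mD) setT (~` D))//; last 2 first.
- exact: measurableC.
- by rewrite /= /mrestr setICl measure0.
rewrite setTD setCK; apply: eq_measure_integral => A mA AD.
by rewrite /= /mrestr setIidl.
Qed.

Section polar.
Context {R : realType} (n : nat) d (T : measurableType d).
Variable dir : n.-tuple R -> T.
Hypothesis mdir : measurable_fun setT dir.
Hypothesis dir_scale : forall (s : R) x, 0 < s -> dir (tuple_scale s x) = dir x.

Let mu := lebesgue_tuple R n.
Let B := [set x : n.-tuple R | enorm x < 1].
Let mB : measurable B := @measurable_enorm_lt R n 1.

(** The dilation by 1 / a turns the sector of radius a into the sector of radius
1, because dir depends only on the direction of its argument. *)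
Lemma lebesgue_tuple_sector (a : R) (C : set T) : 0 < a -> measurable C ->
  (mu ([set x | (enorm x < a)%R] `&` dir @^-1` C) =
   (a ^+ n)%:E * mu (B `&` dir @^-1` C))%E.
Proof.
move=> a0 mC; have a'0 : 0 < a^-1 by rewrite invr_gt0.
have mdC : measurable (dir @^-1` C) by rewrite -[X in measurable X]setTI; exact: mdir.
rewrite -[a in RHS]invrK exprVn -lebesgue_tuple_scale//; last exact: measurableI.
congr (mu _); apply/seteqP; split => x /=; rewrite /B/= enorm_scale ?(ltW a'0)//
  dir_scale// mulrC ltr_pdivrMr// mul1r//.
Qed.

Let b := fine (mu B).

Let bE : b%:E = mu B.
Proof. by rewrite fineK// ge0_fin_numE ?measure_ge0//; exact: lebesgue_tuple_ball_lty. Qed.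

Let b_ge0 : 0 <= b.
Proof. by rewrite fine_ge0. Qed.

(** The radius and the direction of a point are independent under the Lebesgue
measure. Both sides are measures in A, and they agree on half-lines since each
sector has volume proportional to a^n. *)
Lemma polar_rectangle (A : set R) (C : set T) : measurable A -> measurable C ->
  (mu B * mu ([set x | A (enorm x)] `&` dir @^-1` C) =
   mu [set x | A (enorm x)] * mu (B `&` dir @^-1` C))%E.
Proof.
move=> mA mC.
have mdC : measurable (dir @^-1` C) by rewrite -[X in measurable X]setTI; exact: mdir.
have fin_muC : mu (B `&` dir @^-1` C) \is a fin_num.
  rewrite ge0_fin_numE ?measure_ge0//; apply: le_lt_trans (@lebesgue_tuple_ball_lty R n 1).
  by apply: le_measure; rewrite ?inE//; exact: measurableI.
pose c := fine (mu (B `&` dir @^-1` C)).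
have cE : c%:E = mu (B `&` dir @^-1` C) by rewrite fineK.
have c0 : 0 <= c by rewrite fine_ge0.
pose m1 := mscale (NngNum b_ge0)
  (measure_function_pushforward__canonical__measure_function_Measure
     (mrestr mu mdC) (@measurable_enorm R n)).
pose m2 := mscale (NngNum c0)
  (measure_function_pushforward__canonical__measure_function_Measure
     mu (@measurable_enorm R n)).
have m1E X : m1 X = (b%:E * mu (@enorm R n @^-1` X `&` dir @^-1` C))%E by [].
have m2E X : m2 X = (c%:E * mu (@enorm R n @^-1` X))%E by [].
have : m1 A = m2 A.
  apply: (measure_unique (@RGenInftyO.G R) (fun k => `]-oo, (k%:R : R)[%classic)) => //.
  - exact: RGenInftyO.measurableE.
  - move=> _ _ [x ->] [y ->]; exists (Num.min x y).
    by apply/seteqP; split => z /=; rewrite !in_itv/= lt_min => /andP.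
  - by move=> k; exists k%:R.
  - apply/seteqP; split => // x _; exists (Num.trunc `|x|).+1 => //=.
    rewrite in_itv/= (le_lt_trans (ler_norm _))//.
    exact: truncnS_gt.
  - move=> _ [x ->].
    rewrite [LHS]m1E [RHS]m2E.
    rewrite (_ : _ @^-1` _ = [set y | enorm y < x]); last first.
      by apply/seteqP; split => y /=; rewrite in_itv.
    have [x0|x0] := ltP 0 x.
      have := lebesgue_tuple_sector x0 measurableT.
      rewrite preimage_setT !setIT => ->; rewrite lebesgue_tuple_sector//.
      by rewrite bE cE muleCA [RHS]muleC -muleA; congr (_ * _)%E; rewrite muleC.
    rewrite (_ : [set y | _] = set0) ?set0I ?measure0 ?mule0//.
    by apply/seteqP; split => y //= yx; have := enorm_ge0 y; lra.
  - move=> k; rewrite [X in (X < _)%E]m1E lte_mul_pinfty ?lee_fin//.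
    apply: le_lt_trans (@lebesgue_tuple_ball_lty R n k%:R).
    apply: le_measure; rewrite ?inE.
    - apply: measurableI => //.
      by rewrite -[X in measurable X]setTI; exact: measurable_enorm.
    - exact: measurable_enorm_lt.
    - by move=> y /= []; rewrite in_itv.
rewrite [LHS in LHS = _ -> _]m1E [RHS in _ = RHS -> _]m2E.
by rewrite bE cE => ->; rewrite muleC.
Qed.

(** Integration in polar coordinates, without a surface measure: averaging over
the unit ball B, a sector of every direction, plays the part of averaging over
directions, hence the factor mu B. *)
Lemma polar_integral (G : R * T -> \bar R) :
  measurable_fun setT G -> (forall p, 0 <= G p)%E ->
  (mu B * \int[mu]_y G (enorm y, dir y) =
   \int[mu]_y \int[mu]_(z in B) G (enorm y, dir z))%E.
Proof.
move=> mG G0.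
have mf1 : measurable_fun [set: n.-tuple R] (fun y => (enorm y, dir y)).
  by apply/measurable_fun_pairP; split => //; exact: measurable_enorm.
have mf2 : measurable_fun [set: n.-tuple R * n.-tuple R]
    (fun p => (enorm p.1, dir p.2)).
  apply/measurable_fun_pairP; split => /=.
    exact: measurableT_enorm.
  exact: (measurableT_comp mdir measurable_snd).
have mD : measurable ([set: n.-tuple R] `*` B) by exact: measurableX.
pose m1 := mscale (NngNum b_ge0)
  (measure_function_pushforward__canonical__measure_function_Measure mu mf1).
pose m2 := measure_function_pushforward__canonical__measure_function_Measure
  (mrestr (mu \x mu)%E mD) mf2.
have m1E X : m1 X = (b%:E * mu ((fun y => (enorm y, dir y)) @^-1` X))%E by [].
have m2E X : m2 X = ((mu \x mu) ((fun p => (enorm p.1, dir p.2)) @^-1` X `&`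
  ([set: n.-tuple R] `*` B)))%E by [].
have m12 X : measurable X -> m1 X = m2 X.
  pose C : set (set (R * T)) :=
    [set C | exists A, measurable A /\ exists B, measurable B /\ C = A `*` B].
  apply: (measure_unique C (fun k => `]-oo, (k%:R : R)[%classic `*` setT)).
  - rewrite measurable_prod_measurableType //; congr (<<s _ >>).
    rewrite predeqE; split => [[A mA [A' mA' <-]]|[A [mA [A' [mA' ->]]]]].
      by exists A; split => //; exists A'.
    by exists A => //; exists A'.
  - move=> /= _ _ [X1 [mX1 [X2 [mX2 ->]]]] [Y1 [mY1 [Y2 [mY2 ->]]]].
    rewrite -setXI; exists (X1 `&` Y1); split; first exact: measurableI.
    by exists (X2 `&` Y2); split => //; exact: measurableI.
  - move=> k; exists `]-oo, (k%:R : R)[%classic; split; first exact: measurable_itv.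
    by exists setT.
  - apply/seteqP; split => // -[x t] _; exists (Num.trunc `|x|).+1 => //=.
    by rewrite in_itv/= (le_lt_trans (ler_norm _))// truncnS_gt.
  - move=> _ [A [mA [A' [mA' ->]]]].
    rewrite [LHS]m1E [RHS]m2E bE.
    rewrite (_ : _ @^-1` (A `*` A') = [set x | A (enorm x)] `&` dir @^-1` A')//.
    rewrite polar_rectangle// -product_measure1E//.
    - congr (product_measure1 _ _ _); apply/seteqP; split => -[x y] /=; tauto.
    - exact: measurable_preimage_enorm.
    - apply: measurableI => //.
      by rewrite -[X in measurable X]setTI; exact: mdir.
  - move=> k; rewrite [X in (X < _)%E]m1E lte_mul_pinfty ?lee_fin//.
    apply: le_lt_trans (@lebesgue_tuple_ball_lty R n k%:R).
    apply: le_measure; rewrite ?inE.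
    - by rewrite -[X in measurable X]setTI; apply: (mf1) => //; exact: measurableX.
    - exact: measurable_enorm_lt.
    - by move=> y /= []; rewrite in_itv.
transitivity (\int[m1]_p G p)%E.
  rewrite ge0_integral_mscale//; congr (_ * _)%E; first by rewrite -bE.
  by rewrite (@ge0_integral_pushforward _ _ _ _ _ _ mf1).
rewrite (eq_measure_integral m2); last by move=> A mA _; exact: m12.
rewrite (@ge0_integral_pushforward _ _ _ _ _ _ mf2)//.
rewrite preimage_setT ge0_integral_mrestr//; last 2 first.
- exact: (measurableT_comp mG mf2).
- by move=> p; exact: G0.
rewrite integral_mkcond fubini_tonelli1; last 2 first.
- apply/(measurable_restrictT _ mD); apply: measurable_funTS.
  exact: (measurableT_comp mG mf2).
- by move=> p; apply: erestrict_ge0 => q _; exact: G0.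
apply: eq_integral => y _; rewrite /fubini_F [RHS]integral_mkcond.
by apply: eq_integral => z _; rewrite !patchE/= in_setX in_setT.
Qed.

Lemma polar_integral2 (Phi : R * R * T -> \bar R) :
  measurable_fun setT Phi -> (forall p, 0 <= Phi p)%E ->
  (mu B * \int[mu]_x \int[mu]_y Phi (enorm x, enorm y, dir y) =
   \int[mu]_x \int[mu]_y \int[mu]_(z in B) Phi (enorm x, enorm y, dir z))%E.
Proof.
move=> mPhi Phi0; rewrite -bE -ge0_integralZl_EFin//.
- apply: eq_integral => x _; rewrite bE.
  rewrite (polar_integral (G := fun p => Phi (enorm x, p.1, p.2)))//.
  apply: (measurableT_comp mPhi).
  by apply: measurable_fun_pair => //; exact: measurable_fun_pair.
- by move=> x _; exact: integral_ge0.
- apply: (@measurable_fun_fubini_tonelli_F _ _ _ _ _ _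
    (fun p => Phi (enorm p.1, enorm p.2, dir p.2))) => //.
  apply: (measurableT_comp mPhi); apply: measurable_fun_pair.
    by apply: measurable_fun_pair; exact: measurableT_enorm.
  exact: (measurableT_comp mdir measurable_snd).
Qed.

(** After polar_integral the direction of y is carried by a third, independent
point z, and then x and y enter only through their radii, so they may be
exchanged. This replaces rotation invariance: a kernel that depends on the two
radii and on the direction of one point may be made symmetric in the radii. *)
Lemma radius_swap (Phi : R * R * T -> \bar R) :
  measurable_fun setT Phi -> (forall p, 0 <= Phi p)%E ->
  (\int[mu]_x \int[mu]_y Phi (enorm x, enorm y, dir y) =
   \int[mu]_x \int[mu]_y Phi (enorm y, enorm x, dir y))%E.
Proof.
move=> mPhi Phi0.
pose Phi' (p : R * R * T) := Phi (p.1.2, p.1.1, p.2).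
have mPhi' : measurable_fun setT Phi'.
  apply: (measurableT_comp mPhi); apply: measurable_fun_pair => //.
  by apply: measurable_fun_pair; exact: measurableT_comp.
pose K (p : n.-tuple R * n.-tuple R) :=
  (\int[mu]_(z in B) Phi (enorm p.1, enorm p.2, dir z))%E.
have mK : measurable_fun setT K.
  pose F (q : n.-tuple R * n.-tuple R * n.-tuple R) :=
    ((fun q => Phi (enorm q.1.1, enorm q.1.2, dir q.2)) \_ (setT `*` B)) q.
  have -> : K = fun p => (\int[mu]_z F (p, z))%E.
    apply/funext => p; rewrite /K integral_mkcond; apply: eq_integral => z _.
    by rewrite /F !patchE/= in_setX in_setT.
  apply: measurable_fun_fubini_tonelli_F; last by move=> q; rewrite erestrict_ge0.
  apply/(measurable_restrictT _ (measurableX measurableT mB)).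
  apply: measurable_funTS; apply: (measurableT_comp mPhi).
  apply: measurable_fun_pair; last exact: (measurableT_comp mdir measurable_snd).
  by apply: measurable_fun_pair; apply: measurableT_enorm; exact: measurableT_comp.
have K0 p : (0 <= K p)%E by apply: integral_ge0.
have b_gt0 : 0 < b.
  by rewrite -lte_fin bE; exact: lebesgue_tuple_ball_gt0.
have cancelB (X Y : \bar R) : (mu B * X = mu B * Y)%E -> X = Y.
  rewrite -bE => XY.
  rewrite -[LHS]mul1e -[RHS]mul1e -(mulVf (lt0r_neq0 b_gt0)) EFinM -!muleA.
  by rewrite XY.
apply: cancelB.
have H1 := polar_integral2 mPhi Phi0.
have H2 := polar_integral2 mPhi' (fun p => Phi0 _).
exact: (etrans H1 (etrans (fubini_tonelli (m1 := mu) (m2 := mu) K mK K0) (esym H2))).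
Qed.

End polar.

(** * Spheres and the constant gamma *)

Section spheres.
Context {R : realType}.

Lemma lebesgue_tuple_ball n (a : R) : 0 < a ->
  lebesgue_tuple R n [set x | enorm x < a] =
  ((a ^+ n)%:E * lebesgue_tuple R n [set x | (enorm x < 1)%R])%E.
Proof.
move=> a0.
have := @lebesgue_tuple_sector R n _ R (fun=> 0) (measurable_cst _) _ a setT a0.
by rewrite preimage_setT !setIT; apply.
Qed.

(** The sphere lies between the balls of radii r and r + e, whose volumes differ
by a multiple of (r + e)^n - r^n, and that is at most a constant times e. *)
Lemma lebesgue_tuple_sphere n (r : R) : (0 < n)%N ->
  lebesgue_tuple R n [set x | enorm x = r] = 0%E.
Proof.
move=> n0; set mu := lebesgue_tuple R n.
have [r0|r0] := ltP r 0.
  rewrite (_ : [set _ | _] = set0) ?measure0//.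
  by apply/seteqP; split => x //= xr; have := enorm_ge0 x; lra.
have mS : measurable [set x : n.-tuple R | enorm x = r].
  exact: (measurable_preimage_enorm (A := [set r])).
pose b := fine (mu [set x | enorm x < 1]).
have bE : b%:E = mu [set x | enorm x < 1].
  by rewrite fineK// ge0_fin_numE ?measure_ge0//; exact: lebesgue_tuple_ball_lty.
have b0 : 0 <= b by rewrite fine_ge0.
(* a Lipschitz constant of s |-> s^n on [r, r + 1] *)
pose C := \sum_(i < n) (r + 1) ^+ n.-1.
have C0 : 0 <= C by apply: sumr_ge0 => i _; rewrite exprn_ge0// addr_ge0.
have key e : 0 < e -> e <= 1 ->
    (mu [set x | enorm x = r] <= (e * (C * b))%:E)%E.
  move=> e0 e1.
  have H : (mu [set x | enorm x = r] + mu [set x | (enorm x < r)%R] <=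
            mu [set x | (enorm x < r + e)%R])%E.
    rewrite -measureU//.
    - apply: le_measure; rewrite ?inE.
      + by apply: measurableU => //; exact: measurable_enorm_lt.
      + exact: measurable_enorm_lt.
      + by move=> x /= [->|]; lra.
    - exact: measurable_enorm_lt.
    - by apply/seteqP; split => x //= [-> ]; rewrite ltxx.
  have Hr : mu [set x | enorm x < r] = (r ^+ n * b)%:E.
    move: r0; rewrite le_eqVlt => /predU1P[<-|r0].
      rewrite expr0n gtn_eqF//= mul0r (_ : [set _ | _] = set0) ?measure0//.
      by apply/seteqP; split => x //=; rewrite ltNge enorm_ge0.
    by rewrite lebesgue_tuple_ball// -/mu -bE.
  move: H; rewrite Hr lebesgue_tuple_ball -/mu -?bE; last lra.
  rewrite -leeBrDr// -EFinM -EFinB => /le_trans; apply.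
  rewrite lee_fin -mulrBl subrXX mulrA ler_wpM2r//.
  rewrite (_ : r + e - r = e); last ring.
  rewrite ler_pM2l// /C; apply: ler_sum => i _.
  apply: (@le_trans _ _ ((r + 1) ^+ (n.-1 - i) * (r + 1) ^+ i)).
    by apply: ler_pM; rewrite ?exprn_ge0 ?addr_ge0 ?(ltW e0)// lerXn2r// ?nnegrE; lra.
  by rewrite -exprD subnK// -ltnS prednK.
apply/eqP; rewrite eq_le measure_ge0 andbT.
apply/lee_addgt0Pr => e e0; rewrite add0e.
pose d := Num.min 1 (e / (C * b + 1)).
have Cb : 0 <= C * b by rewrite mulr_ge0.
have d0 : 0 < d by rewrite /d lt_min ltr01/= divr_gt0//; lra.
apply: le_trans (key d d0 _) _; first by rewrite /d ge_min lexx.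
rewrite lee_fin; apply: (@le_trans _ _ (e / (C * b + 1) * (C * b))).
  by rewrite ler_wpM2r// /d ge_min lexx orbT.
rewrite mulrAC ler_pdivrMr; last lra.
by rewrite ler_pM2l//; lra.
Qed.

Lemma unit_coneE n : unit_cone (@unit_sphere R n `&` @unit_sphere R n) =
  [set x | 0 < enorm x <= 1].
Proof.
rewrite setIid; apply/seteqP; split => x /=.
  move=> [r [t [/andP[r0 r1] tS ->]]]; rewrite enorm_scale ?(ltW r0)// tS mulr1.
  by rewrite r0.
move=> /andP[x0 x1]; exists (enorm x), (tuple_scale (enorm x)^-1 x); split.
- by rewrite x0.
- by rewrite /unit_sphere/= enorm_scale ?invr_ge0 ?enorm_ge0// mulVf// gt_eqF.
- by apply: eq_from_tnth => i; rewrite !tnth_mktuple mulrA divff ?mul1r// gt_eqF.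
Qed.

Lemma gamma_gt0 n : 0 < gamma_ R n.
Proof.
rewrite /gamma_ mulr_gt0// ?divr_gt0 ?ltr0n ?fact_gt0//.
rewrite /sphere_area /surface_measure unit_coneE.
set mu := lebesgue_tuple R n.+1.
have mC : measurable [set x : n.+1.-tuple R | 0 < enorm x <= 1].
  rewrite (_ : [set _ | _] = [set x | (`]0, 1]%classic : set R) (enorm x)]).
    exact: measurable_preimage_enorm.
  by apply/seteqP; split => x /=; rewrite in_itv.
rewrite fine_gt0// mule_gt0 ?lte_fin ?ltr0n//=.
  rewrite lte_mul_pinfty//; apply: le_lt_trans (@lebesgue_tuple_ball_lty R n.+1 2).
  apply: le_measure; rewrite ?inE//; first exact: measurable_enorm_lt.
  by move=> x /= /andP[_]; lra.
apply: lt_le_trans (@lebesgue_tuple_ball_gt0 R n.+1 1 ltr01) _.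
have mS : measurable [set x : n.+1.-tuple R | enorm x = 0].
  exact: (measurable_preimage_enorm (A := [set 0])).
apply: (@le_trans _ _ (mu ([set x | (0 < enorm x <= 1)%R] `|` [set x | enorm x = 0]))).
  apply: le_measure; rewrite ?inE//; first exact: measurable_enorm_lt.
    exact: measurableU.
  move=> x /= x1; have := enorm_ge0 x; rewrite le_eqVlt => /predU1P[<-|->]; first by right.
  by left; rewrite ltW.
apply: le_trans (measureU2 mu mC mS) _.
by rewrite [X in (_ + X)%E](lebesgue_tuple_sphere 0 (ltn0Sn n)) adde0.
Qed.

End spheres.

(** * Logarithmic means of the distance to a point on a circle *)

Section log_mean.
Context {R : realType}.
Implicit Types a b r s t h k : R.

(** This is the square of the geometric mean of the distance from a point y to
the points of a planar circle of radius r centred at the origin, where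
a = r^2, b = |y|^2 and t is the share of |y|^2 carried by the plane of the
circle. It is the larger root c of c^2 - (a + b) c + a b t = 0, and every
estimate below is read off that equation. *)
Definition sq_geo_mean a b t : R :=
  (a + b + Num.sqrt ((a + b) ^+ 2 - 4 * (a * b * t))) / 2.

(** The mean of ln |x - y| over the circle that sq_geo_mean refers to, at radius
r with |y| = s; see circle_integral_log_kernel. The formula is symmetric in r
and s although the two radii play different parts. *)
Definition log_mean r s t : R := ln (sq_geo_mean (r ^+ 2) (s ^+ 2) t) / 2.

Lemma disc_ge a b t : 0 <= a -> 0 <= b -> t <= 1 ->
  (a - b) ^+ 2 <= (a + b) ^+ 2 - 4 * (a * b * t).
Proof.
move=> a0 b0 t1; have ab : 0 <= a * b by rewrite mulr_ge0.
have : a * b * t <= a * b * 1 by rewrite ler_wpM2l.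
nra.
Qed.

Lemma disc_ge0 a b t : 0 <= a -> 0 <= b -> t <= 1 ->
  0 <= (a + b) ^+ 2 - 4 * (a * b * t).
Proof. by move=> a0 b0 t1; apply: le_trans (disc_ge a0 b0 t1); exact: sqr_ge0. Qed.

Lemma sq_geo_mean_root a b t : 0 <= a -> 0 <= b -> t <= 1 ->
  sq_geo_mean a b t ^+ 2 = (a + b) * sq_geo_mean a b t - a * b * t.
Proof.
move=> a0 b0 t1; have := sqr_sqrtr (disc_ge0 a0 b0 t1); rewrite /sq_geo_mean.
set S := Num.sqrt _ => SE.
by rewrite !expr2 in SE *; lra.
Qed.

Lemma le_sq_geo_mean a b t x :
  x ^+ 2 - (a + b) * x + a * b * t <= 0 -> x <= sq_geo_mean a b t.
Proof.
move=> xab; rewrite /sq_geo_mean ler_pdivlMr// -lerBlDl.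
apply: le_trans (ler_norm _) _; rewrite -sqrtr_sqr ler_wsqrtr//.
nra.
Qed.

Lemma sq_geo_mean_gel a b t : 0 <= a -> 0 <= b -> t <= 1 ->
  a <= sq_geo_mean a b t.
Proof.
move=> a0 b0 t1; apply: le_sq_geo_mean.
have ab : 0 <= a * b by rewrite mulr_ge0.
have : a * b * t <= a * b * 1 by rewrite ler_wpM2l.
nra.
Qed.

Lemma sq_geo_meanC a b t : sq_geo_mean a b t = sq_geo_mean b a t.
Proof. by rewrite /sq_geo_mean (addrC a) (mulrC a). Qed.

Lemma sq_geo_mean_ger a b t : 0 <= a -> 0 <= b -> t <= 1 ->
  b <= sq_geo_mean a b t.
Proof. by move=> a0 b0 t1; rewrite sq_geo_meanC sq_geo_mean_gel. Qed.

Lemma sq_geo_mean_scale k a b t : 0 <= k ->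
  sq_geo_mean (k * a) (k * b) t = k * sq_geo_mean a b t.
Proof.
move=> k0; rewrite /sq_geo_mean.
rewrite (_ : (_ + _) ^+ 2 - _ = k ^+ 2 * ((a + b) ^+ 2 - 4 * (a * b * t))); last ring.
by rewrite sqrtrM ?sqr_ge0// sqrtr_sqr ger0_norm//; field.
Qed.

(** The root c for a satisfies c >= b >= b t, so raising a lowers the value of
the quadratic at c. *)
Lemma sq_geo_mean_mono a a' b t : 0 <= a -> a <= a' -> 0 <= b -> 0 <= t <= 1 ->
  sq_geo_mean a b t <= sq_geo_mean a' b t.
Proof.
move=> a0 aa' b0 /andP[t0 t1]; apply: le_sq_geo_mean.
rewrite sq_geo_mean_root//.
have := sq_geo_mean_ger a0 b0 t1; set c := sq_geo_mean _ _ _ => bc.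
have btc : b * t <= c by apply: le_trans bc; rewrite ler_piMr.
have : 0 <= (a' - a) * (c - b * t) by rewrite mulr_ge0// subr_ge0.
lra.
Qed.

(** The sharper growth outside the ball of radius |y|, where the mean of ln |x - y|
increases at least at half the rate of ln r: the quadratic for k^2 a takes at
k c the value c k (k - 1) (b - k a), which is nonpositive as soon as b <= a. *)
Lemma sq_geo_mean_growth k a b t : 1 <= k -> 0 <= b -> b <= a -> t <= 1 ->
  k * sq_geo_mean a b t <= sq_geo_mean (k ^+ 2 * a) b t.
Proof.
move=> k1 b0 ba t1; apply: le_sq_geo_mean.
have a0 : 0 <= a by exact: le_trans ba.
rewrite exprMn sq_geo_mean_root//.
have := sq_geo_mean_ger a0 b0 t1; set c := sq_geo_mean _ _ _ => bc.
have c0 : 0 <= c by exact: le_trans bc.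
have : 0 <= c * k * ((k - 1) * (k * a - b)).
  have k0 : 0 <= k by lra.
  have bka : b <= k * a by apply: (le_trans ba); rewrite ler_peMl.
  by apply: mulr_ge0; apply: mulr_ge0; rewrite ?subr_ge0.
lra.
Qed.

Lemma log_meanC r s t : log_mean r s t = log_mean s r t.
Proof. by rewrite /log_mean sq_geo_meanC. Qed.

Lemma sq_geo_mean_gt0 r s t : 0 < r -> t <= 1 ->
  0 < sq_geo_mean (r ^+ 2) (s ^+ 2) t.
Proof.
move=> r0 t1; apply: lt_le_trans (sq_geo_mean_gel _ _ t1); rewrite ?sqr_ge0//.
by rewrite exprn_gt0.
Qed.

Lemma log_mean_scale h r s t : 0 < r -> t <= 1 ->
  log_mean (expR h * r) (expR h * s) t = h + log_mean r s t.
Proof.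
move=> r0 t1; rewrite /log_mean !exprMn sq_geo_mean_scale ?sqr_ge0//.
rewrite lnM ?posrE ?exprn_gt0 ?expR_gt0 ?sq_geo_mean_gt0//.
by rewrite lnXn ?expR_gt0// expRK; field.
Qed.

Definition log_mean_diff h r s t : R := log_mean r s t - log_mean (expR (- h) * r) s t.

(** The lower bound is monotonicity in the radius. For the upper bound, dilating
both radii by e^h adds exactly h, and dilating only one of them adds less, by
monotonicity in the other. *)
Lemma log_mean_diff_bound h r s t : 0 <= h -> 0 < r -> 0 <= s -> 0 <= t <= 1 ->
  0 <= log_mean (expR h * r) s t - log_mean r s t <= h.
Proof.
move=> h0 r0 s0 /[dup] t01 /andP[t0 t1].
have e1 : 1 <= expR h by rewrite -expR0 ler_expR.
have ehr0 : 0 < expR h * r by rewrite mulr_gt0// expR_gt0.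
apply/andP; split.
  rewrite subr_ge0 /log_mean ler_pM2r// ler_ln ?posrE ?sq_geo_mean_gt0//.
  apply: sq_geo_mean_mono; rewrite ?sqr_ge0// ler_sqr ?nnegrE ?(ltW r0) ?(ltW ehr0)//.
  by rewrite ler_peMl// ltW.
rewrite lerBlDr -log_mean_scale// log_meanC [leRHS]log_meanC.
rewrite /log_mean ler_pM2r// ler_ln ?posrE; last 2 first.
- by rewrite sq_geo_meanC sq_geo_mean_gt0.
- by rewrite sq_geo_meanC sq_geo_mean_gt0.
by apply: sq_geo_mean_mono; rewrite ?sqr_ge0// ler_sqr ?nnegrE ?mulr_ge0 ?expR_ge0// ler_peMl.
Qed.

Lemma log_mean_diff0 h s t : log_mean_diff h 0 s t = 0.
Proof. by rewrite /log_mean_diff mulr0 subrr. Qed.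

Lemma log_mean_diff_ge0 h r s t : 0 <= h -> 0 <= r -> 0 <= s -> 0 <= t <= 1 ->
  0 <= log_mean_diff h r s t <= h.
Proof.
move=> h0; rewrite le_eqVlt => /predU1P[<-|r0] s0 t01.
  by rewrite log_mean_diff0 lexx.
have := @log_mean_diff_bound h (expR (- h) * r) s t h0 _ s0 t01.
by rewrite mulrA -expRD subrr expR0 mul1r; apply; rewrite mulr_gt0// expR_gt0.
Qed.

Lemma log_mean_diff_le0 h r s t : h <= 0 -> 0 <= r -> 0 <= s -> 0 <= t <= 1 ->
  h <= log_mean_diff h r s t <= 0.
Proof.
move=> h0; rewrite le_eqVlt => /predU1P[<-|r0] s0 t01.
  by rewrite log_mean_diff0 h0 lexx.
have := @log_mean_diff_bound (- h) r s t _ r0 s0 t01.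
by rewrite oppr_ge0 => /(_ h0) /andP[h1 h2]; rewrite /log_mean_diff; lra.
Qed.

Lemma norm_log_mean_diff h r s t : 0 <= r -> 0 <= s -> 0 <= t <= 1 ->
  `|log_mean_diff h r s t| <= `|h|.
Proof.
move=> r0 s0 t01; have [h0|/ltW h0] := leP 0 h.
  by have /andP[? ?] := log_mean_diff_ge0 h0 r0 s0 t01; rewrite !ger0_norm.
by have /andP[? ?] := log_mean_diff_le0 h0 r0 s0 t01; rewrite !ler0_norm// lerN2.
Qed.

Lemma log_mean_diff_half h r s t : 0 <= h -> 0 < r -> 0 <= s -> t <= 1 ->
  s <= expR (- h) * r -> h / 2 <= log_mean_diff h r s t.
Proof.
move=> h0 r0 s0 t1 sr; rewrite /log_mean_diff /log_mean -mulrBl ler_pM2r//.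
have er0 : 0 < expR (- h) * r by rewrite mulr_gt0// expR_gt0.
have c0 := sq_geo_mean_gt0 s er0 t1.
rewrite lerBrDr -[X in X + _](expRK h) -lnM ?posrE ?expR_gt0//.
rewrite ler_ln ?posrE ?sq_geo_mean_gt0//; last by rewrite mulr_gt0 ?expR_gt0.
have -> : r ^+ 2 = expR h ^+ 2 * (expR (- h) * r) ^+ 2.
  by rewrite -exprMn mulrA -expRD subrr expR0 mul1r.
apply: sq_geo_mean_growth; rewrite ?sqr_ge0//.
  by rewrite -expR0 ler_expR.
by rewrite ler_sqr ?nnegrE ?(ltW er0).
Qed.

Lemma derivable1_comp (f g : R -> R) x :
  derivable f x 1 -> derivable g (f x) 1 -> derivable (g \o f) x 1.
Proof.
by move=> /derivableP df /derivableP dg; apply: ex_derive.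
Qed.

(** Off r = s the discriminant of the quadratic is at least (r^2 - s^2)^2 > 0, so
its root is a smooth function of the coefficients. *)
Lemma derivable_log_mean r s t : 0 < r -> 0 < s -> r != s -> t <= 1 ->
  derivable (fun h => log_mean (expR h * r) s t) 0 1.
Proof.
move=> r0 s0 rs t1.
pose a : R -> R := (expR * cst r) ^+ 2.
have dr k : derivable (cst k : R -> R) 0 1 by exact: derivable_cst.
have da : derivable a 0 1.
  by apply/derivableX/(derivableM _ (dr r)); exact: derivable_expR.
pose D : R -> R := (a + cst (s ^+ 2)) ^+ 2 - cst 4 * (a * cst (s ^+ 2) * cst t).
have dD : derivable D 0 1.
  apply: derivableB; first by apply/derivableX/(derivableD da (dr _)).
  exact: (derivableM (dr _) (derivableM (derivableM da (dr _)) (dr _))).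
have aE h : a h = (expR h * r) ^+ 2 by [].
have a0 : a 0 = r ^+ 2 by rewrite aE expR0 mul1r.
have DE h : D h = (a h + s ^+ 2) ^+ 2 - 4 * (a h * s ^+ 2 * t) by [].
have D0 : 0 < D 0.
  rewrite DE a0; apply: lt_le_trans (disc_ge (sqr_ge0 r) (sqr_ge0 s) t1).
  rewrite exprn_even_gt0//= subr_sqr mulf_neq0// ?subr_eq0//.
  by rewrite gt_eqF// addr_gt0.
have dS : derivable (Num.sqrt \o D) 0 1.
  by have [ds _] := is_derive1_sqrt D0; exact: derivable1_comp dD ds.
pose c : R -> R := (a + cst (s ^+ 2) + (Num.sqrt \o D)) * cst 2^-1.
have dc : derivable c 0 1.
  exact: (derivableM (derivableD (derivableD da (dr _)) dS) (dr _)).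
have cE h : c h = (a h + s ^+ 2 + Num.sqrt (D h)) / 2 by [].
have c0 : 0 < c 0.
  by have := sq_geo_mean_gt0 s r0 t1; rewrite /sq_geo_mean cE DE a0.
have -> : (fun h => log_mean (expR h * r) s t) = (@ln R \o c) * cst 2^-1.
  by apply/funext => h.
apply: (derivableM _ (dr _)).
by have [dl _] := is_derive1_ln c0; exact: derivable1_comp dc dl.
Qed.

Lemma derivable_quotient_cvg (g : R -> R) x (u : R^nat) : derivable g x 1 ->
  (forall n, u n != 0) -> u n @[n --> \oo] --> 0 ->
  (g (u n + x) - g x) / u n @[n --> \oo] --> 'D_1 g x.
Proof.
move=> dg u_neq0 u_cvg0.
have /cvgr_dnbhsP /(_ u (conj u_neq0 u_cvg0)) := dg.
apply: cvg_trans; apply: near_eq_cvg; near=> n => /=.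
by rewrite [_ *: 1]mulr1 [RHS]mulrC.
Unshelve. all: by end_near.
Qed.

(** By symmetry and homogeneity the second increment equals h minus the next
increment of the first function, so the quotient differs from 1 by a second
difference quotient of a differentiable function. *)
Lemma log_mean_diff_swap_cvg r s t (u : R^nat) :
  0 < r -> 0 < s -> r != s -> t <= 1 ->
  (forall n, u n != 0) -> u n @[n --> \oo] --> 0 ->
  (log_mean_diff (u n) r s t + log_mean_diff (u n) s r t) / u n
    @[n --> \oo] --> (1 : R).
Proof.
move=> r0 s0 rs t1 u_neq0 u_cvg0.
have dg := derivable_log_mean r0 s0 rs t1.
set g := (X in derivable X _ _) in dg.
have Nu_neq0 n : - u n != 0 by rewrite oppr_eq0.
have Nu_cvg0 : - u n @[n --> \oo] --> (0 : R).
  by rewrite -[X in _ --> X]oppr0; exact: cvgN.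
have H := cvgB (derivable_quotient_cvg dg Nu_neq0 Nu_cvg0)
             (derivable_quotient_cvg dg u_neq0 u_cvg0).
rewrite subrr in H; rewrite -[X in _ --> X](addr0 (1 : R)).
pose q n := (g (- u n + 0) - g 0) / - u n - (g (u n + 0) - g 0) / u n.
have H1 : 1 + q n @[n --> \oo] --> (1 + 0 : R) by apply: cvgD; [exact: cvg_cst|exact: H].
apply: cvg_trans H1; apply: near_eq_cvg; near=> n; rewrite /q.
have -> : log_mean_diff (u n) s r t = u n - (g (u n + 0) - g 0).
  rewrite /log_mean_diff /g addr0 expR0 mul1r.
  rewrite (log_meanC s r) (log_meanC (_ * s)).
  have := log_mean_scale (- u n) s (mulr_gt0 (expR_gt0 (u n)) r0) t1.
  by rewrite mulrA -expRD addNr expR0 mul1r => ->; ring.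
have -> : log_mean_diff (u n) r s t = - (g (- u n + 0) - g 0).
  by rewrite /log_mean_diff /g addr0 expR0 mul1r opprB.
by field.
Unshelve. all: by end_near.
Qed.

End log_mean.

(** * Jensen formula for a linear function on the unit disk *)

Section periodic_integral.
Context {R : realType}.
Implicit Types (h : R -> R).
Local Notation leb := (@lebesgue_measure R).

Definition circle_integral h : \bar R := (\int[leb]_(x in `[0%R, (pi *+ 2)%R[) (h x)%:E)%E.

Lemma ge0_integral_shift h (a u v : R) : measurable_fun setT h -> (forall x, 0 <= h x) ->
  (\int[leb]_(x in `[u, v[) (h (x + a)%R)%:E =
   \int[leb]_(x in `[(u + a)%R, (v + a)%R[) (h x)%:E)%E.
Proof.
move=> mh h0; rewrite integral_mkcond [RHS]integral_mkcond.
pose F : R -> \bar R := (fun x => (h x)%:E) \_ `[u + a, v + a[.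
transitivity (\int[leb]_x F (1 * x + a)%R)%E.
  apply: eq_integral => x _; rewrite /F !patchE mul1r.
  congr (if _ then _ else _); apply/idP/idP; rewrite !inE/= !in_itv/= lerD2r ltrD2r//.
rewrite ge0_integral_affine ?ltr01//; first by rewrite invr1 mul1e.
- rewrite /F; apply/(measurable_restrictT _ (measurable_itv _)).
  by apply: measurable_funTS; exact/measurable_EFinP.
- by move=> x; rewrite /F erestrict_ge0// => ? _; rewrite lee_fin.
Qed.

(** The rotated period is cut at the end of the original one, and its second
piece is moved back by one period. *)
Lemma circle_integral_shift h (a : R) : measurable_fun setT h ->
  (forall x, 0 <= h x) -> periodic h (pi *+ 2) -> 0 <= a <= pi *+ 2 ->
  circle_integral (fun x => h (x + a)) = circle_integral h.
Proof.
move=> mh h0 ph /andP[a0 a2].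
have mhE (D : set R) : measurable_fun D (fun x => (h x)%:E).
  by apply: measurable_funTS; exact/measurable_EFinP.
rewrite /circle_integral ge0_integral_shift// add0r.
have -> : `[a, (pi *+ 2 + a)%R[%classic =
    `[a, (pi *+ 2)%R[%classic `|` `[(0 + pi *+ 2)%R, (a + pi *+ 2)%R[%classic.
  rewrite add0r addrC; apply/seteqP; split => x /=; rewrite !in_itv/=.
    by move=> /andP[h1 h2]; have [h3|h3] := ltP x (pi *+ 2); [left|right]; lra.
  by move=> [|] /andP[h1 h2]; lra.
have hE0 (D : set R) x : D x -> (0 <= (h x)%:E)%E by rewrite lee_fin.
rewrite ge0_integral_setU; [|exact: measurable_itv|exact: measurable_itv
  |exact: mhE|exact: hE0|]; last first.
  apply/disj_setPS => x /=; rewrite !in_itv/= add0r => -[/andP[_ h1] /andP[h2 _]].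
  by move: h1; rewrite ltNge h2.
rewrite -(@ge0_integral_shift h (pi *+ 2) 0 a)//.
under [X in (_ + X)%E]eq_integral do rewrite ph.
have -> : `[0, (pi *+ 2)%R[%classic = `[0, a[%classic `|` `[a, (pi *+ 2)%R[%classic.
  apply/seteqP; split => x /=; rewrite !in_itv/=.
    by move=> /andP[h1 h2]; have [h3|h3] := ltP x a; [left|right]; lra.
  by move=> [|] /andP[h1 h2]; lra.
rewrite [RHS]ge0_integral_setU; [by rewrite addeC|exact: measurable_itv
  |exact: measurable_itv|exact: mhE|exact: hE0|].
apply/disj_setPS => x /=; rewrite !in_itv/= => -[/andP[_ h1] /andP[h2 _]].
by move: h1; rewrite ltNge h2.
Qed.

Lemma twopi_gt0 : 0 < pi *+ 2 :> R.
Proof. by rewrite pmulrn_lgt0// pi_gt0. Qed.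

Lemma circle_integral_cst (M : R) : circle_integral (fun=> M) = (pi *+ 2 * M)%:E.
Proof.
rewrite /circle_integral integral_cst//= lebesgue_measure_itv/= lte_fin.
by rewrite twopi_gt0 -EFinB subr0 -EFinM mulrC.
Qed.

Lemma circle_integralD h1 h2 : measurable_fun setT h1 -> measurable_fun setT h2 ->
  (forall x, 0 <= h1 x) -> (forall x, 0 <= h2 x) ->
  circle_integral (fun x => h1 x + h2 x) = (circle_integral h1 + circle_integral h2)%E.
Proof.
move=> mh1 mh2 h10 h20; rewrite /circle_integral -ge0_integralD//.
- by move=> x _; rewrite lee_fin.
- by apply: measurable_funTS; exact/measurable_EFinP.
- by move=> x _; rewrite lee_fin.
- by apply: measurable_funTS; exact/measurable_EFinP.
Qed.

Lemma le_circle_integral h1 h2 : measurable_fun setT h1 -> measurable_fun setT h2 ->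
  (forall x, 0 <= h1 x) -> (forall x, h1 x <= h2 x) ->
  (circle_integral h1 <= circle_integral h2)%E.
Proof.
move=> mh1 mh2 h10 h12; apply: ge0_le_integral => //.
- by move=> x _; rewrite lee_fin.
- by apply: measurable_funTS; exact/measurable_EFinP.
- by apply: measurable_funTS; exact/measurable_EFinP.
- by move=> x _; rewrite lee_fin.
Qed.

End periodic_integral.

Section jensen_disk.
Context {R : realType}.
Implicit Types (p q x : R) (k : nat).

(** |1 - z|^2 for the complex number z = (p - i q) e^(i x). *)
Definition sq_dist1 p q x : R := 1 - 2 * (p * cos x + q * sin x) + (p ^+ 2 + q ^+ 2).

(** |1 - z| |1 + z| = |1 - z^2|. *)
Lemma sq_dist1_double p q x :
  sq_dist1 p q x * sq_dist1 p q (x + pi) =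
  sq_dist1 (p ^+ 2 - q ^+ 2) (2 * (p * q)) (x *+ 2).
Proof.
rewrite /sq_dist1 cosDpi sinDpi cos_mulr2n sin_mulr2n.
have := cos2Dsin2 x; move: (cos x) (sin x) => c s cs.
apply/eqP; rewrite -subr_eq0.
rewrite (_ : _ - _ = 4 * q ^+ 2 * (1 - (c ^+ 2 + s ^+ 2))); last ring.
by rewrite cs subrr mulr0.
Qed.

Lemma sq_dist1_bounds p q x b : 0 <= b -> p ^+ 2 + q ^+ 2 = b ^+ 2 ->
  (1 - b) ^+ 2 <= sq_dist1 p q x <= (1 + b) ^+ 2.
Proof.
move=> b0 pqb; rewrite /sq_dist1.
have := cos2Dsin2 x; move: (cos x) (sin x) => c s cs.
have : (p * c + q * s) ^+ 2 <= b ^+ 2.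
  rewrite -pqb -[leRHS]mulr1 -cs -subr_ge0.
  rewrite (_ : _ - _ = (p * s - q * c) ^+ 2); last ring.
  exact: sqr_ge0.
rewrite -real_normK ?num_real// ler_sqr ?nnegrE// ler_norml pqb => /andP[h1 h2].
by apply/andP; split; lra.
Qed.

Lemma measurable_ln_sq_dist1 p q (a : R) k :
  measurable_fun setT (fun x => a - ln (sq_dist1 p q (x *+ k))).
Proof.
apply: measurable_funB => //.
apply: (@measurableT_comp _ _ _ _ _ _ (@ln R) _ (fun x : R => sq_dist1 p q (x *+ k))) => //.
have mk : measurable_fun [set: R] (fun x : R => x *+ k) by exact: natmul_measurable.
have mc : measurable_fun [set: R] (@cos R).
  exact: continuous_measurable_fun (@continuous_cos R).
have ms : measurable_fun [set: R] (@sin R).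
  exact: continuous_measurable_fun (@continuous_sin R).
apply: measurable_funD => //; apply: measurable_funB => //.
apply: measurable_funM => //; apply: measurable_funD; apply: measurable_funM => //.
  exact: (measurableT_comp mc mk).
exact: (measurableT_comp ms mk).
Qed.

Let dyadic_mean k p q M := circle_integral (fun x => M - ln (sq_dist1 p q (x *+ 2 ^ k))).

Lemma sq_dist1_gt0 p q x : p ^+ 2 + q ^+ 2 < 1 -> 0 < sq_dist1 p q x.
Proof.
move=> pq1; have pq0 : 0 <= p ^+ 2 + q ^+ 2 by rewrite addr_ge0 ?sqr_ge0.
have := @sq_dist1_bounds p q x _ (sqrtr_ge0 _) (esym (sqr_sqrtr pq0)).
move=> /andP[+ _]; apply: lt_le_trans; rewrite exprn_gt0// subr_gt0.
by rewrite -sqrtr1 ltr_sqrt.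
Qed.

(** The function has period 2 pi / 2^k, hence the same mean after a shift by half
of that period, which changes the sign of z; the two values of the logarithm
add up to the value at z^2. *)
Let dyadic_double k p q M : p ^+ 2 + q ^+ 2 < 1 ->
  (forall x, 0 <= M - ln (sq_dist1 p q x)) ->
  (2%:E * dyadic_mean k p q M)%E = dyadic_mean k.+1 (p ^+ 2 - q ^+ 2) (2 * (p * q)) (2 * M).
Proof.
move=> pq1 M0; pose a : R := pi / (2 ^ k)%:R.
have k2 : (2 ^ k)%:R != 0 :> R by rewrite pnatr_eq0 expn_eq0.
have aE : a *+ 2 ^ k = pi by rewrite -mulr_natr /a divfK.
pose h x := M - ln (sq_dist1 p q (x *+ 2 ^ k)).
have mh : measurable_fun setT h by exact: measurable_ln_sq_dist1.
have h0 x : 0 <= h x by exact: M0.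
have ph : periodic h (pi *+ 2).
  move=> x; rewrite /h /sq_dist1 mulrnDl.
  by rewrite (periodicn (@cosD2pi R)) (periodicn (@sinD2pi R)).
have a_ge0 : 0 <= a by rewrite divr_ge0// pi_ge0.
have a_le : a <= pi *+ 2.
  apply: (@le_trans _ _ pi); last by rewrite mulr2n lerDl pi_ge0.
  by rewrite -aE -mulr_natr ler_peMr// ler1n expn_gt0.
have mha : measurable_fun setT (fun x => h (x + a)).
  apply: (measurableT_comp mh); exact: measurable_funD.
have -> : (2%:E * dyadic_mean k p q M)%E =
    (circle_integral h + circle_integral (fun x => h (x + a)%R))%E.
  rewrite circle_integral_shift//; last by rewrite a_ge0.
  rewrite -[dyadic_mean _ _ _ _]/(circle_integral h).
  by rewrite (mule_natl _ 2) mule2n.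
rewrite -circle_integralD//.
congr (circle_integral _); apply/funext => x; rewrite /h mulrnDl aE.
have -> : x *+ 2 ^ k.+1 = (x *+ 2 ^ k) *+ 2 by rewrite -mulrnA mulnC expnS.
rewrite -sq_dist1_double lnM ?posrE ?sq_dist1_gt0//; ring.
Qed.

Let dyadic_iter k : forall p q M j, p ^+ 2 + q ^+ 2 < 1 ->
  (forall x, 0 <= M - ln (sq_dist1 p q x)) ->
  exists p' q', [/\ p' ^+ 2 + q' ^+ 2 <= p ^+ 2 + q ^+ 2,
    forall x, 0 <= 2 ^+ k * M - ln (sq_dist1 p' q' x) &
    ((2 ^+ k)%:E * dyadic_mean j p q M)%E = dyadic_mean (j + k) p' q' (2 ^+ k * M)].
Proof.
elim: k => [|k IH] p q M j pq1 M0.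
  by exists p, q; split; rewrite ?expr0 ?mul1r ?mul1e ?addn0.
have pqE : (p ^+ 2 - q ^+ 2) ^+ 2 + (2 * (p * q)) ^+ 2 = (p ^+ 2 + q ^+ 2) ^+ 2.
  by ring.
have pq0 : 0 <= p ^+ 2 + q ^+ 2 by rewrite addr_ge0 ?sqr_ge0.
have pq2 : (p ^+ 2 - q ^+ 2) ^+ 2 + (2 * (p * q)) ^+ 2 <= p ^+ 2 + q ^+ 2.
  by rewrite pqE expr2 ler_piMr// ltW.
have M0' x : 0 <= 2 * M - ln (sq_dist1 (p ^+ 2 - q ^+ 2) (2 * (p * q)) x).
  rewrite -[x](mulfVK (_ : 2 != 0 :> R))// mulr_natr -sq_dist1_double.
  rewrite lnM ?posrE ?sq_dist1_gt0//.
  by have := M0 (x / 2); have := M0 (x / 2 + pi); lra.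
have [p' [q' [pq' M' JE]]] := IH _ _ _ j.+1 (le_lt_trans pq2 pq1) M0'.
exists p', q'; rewrite (exprSr _ k) -mulrA; split => //; first exact: (le_trans pq' pq2).
by rewrite EFinM -muleA dyadic_double// JE addSnnS.
Qed.

(** Jensen's formula: ln |1 - z|^2 has mean zero on a circle |z| = b < 1. Squaring
z repeatedly expresses 2^k times the mean as the mean at z^(2^k), which stays
bounded, so the mean vanishes. The constant M makes the integrand nonnegative,
as Tonelli's theorem will require. *)
Lemma circle_integral_ln_sq_dist1 p q M : p ^+ 2 + q ^+ 2 < 1 ->
  (forall x, 0 <= M - ln (sq_dist1 p q x)) ->
  circle_integral (fun x => M - ln (sq_dist1 p q x)) = (pi *+ 2 * M)%:E.
Proof.
move=> pq1 M0.
have -> : circle_integral (fun x => M - ln (sq_dist1 p q x)) = dyadic_mean 0 p q M.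
  by congr (circle_integral _); apply/funext => x; rewrite expn0 mulr1n.
pose b := Num.sqrt (p ^+ 2 + q ^+ 2).
have b0 : 0 <= b by exact: sqrtr_ge0.
have b1 : b < 1 by rewrite -sqrtr1 ltr_sqrt.
(* bounds |ln |1 - z|^2| uniformly for |z| <= b, hence along all the squarings *)
pose C : R := Num.max (ln 4) (- ln ((1 - b) ^+ 2)).
have C_bound p' q' x : p' ^+ 2 + q' ^+ 2 <= p ^+ 2 + q ^+ 2 ->
    - C <= ln (sq_dist1 p' q' x) <= C.
  move=> pq'; have pq'0 : 0 <= p' ^+ 2 + q' ^+ 2 by rewrite addr_ge0 ?sqr_ge0.
  have b'b : Num.sqrt (p' ^+ 2 + q' ^+ 2) <= b by exact: ler_wsqrtr.
  have L0 := sq_dist1_gt0 x (le_lt_trans pq' pq1).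
  have := @sq_dist1_bounds p' q' x _ (sqrtr_ge0 _) (esym (sqr_sqrtr pq'0)).
  move: b'b (sqrtr_ge0 (p' ^+ 2 + q' ^+ 2)); set b' := Num.sqrt _ => b'b b'0 /andP[h1 h2].
  apply/andP; split.
    rewrite lerNl /C le_max; apply/orP; right; rewrite lerN2 ler_ln ?posrE//.
      by apply: le_trans h1; rewrite ler_sqr ?nnegrE; lra.
    by rewrite exprn_gt0; lra.
  rewrite /C le_max; apply/orP; left; rewrite ler_ln ?posrE//.
  by apply: le_trans h2 _; nra.
have Jge k : ((pi *+ 2 * (2 ^+ k * M - C))%:E <= ((2 ^+ k)%:E * dyadic_mean 0 p q M)%E)%E.
  have [p' [q' [pq' M' ->]]] := dyadic_iter k 0 pq1 M0.
  apply: (@le_trans _ _ (circle_integral (fun=> Num.max 0 (2 ^+ k * M - C)))).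
    rewrite circle_integral_cst lee_fin (ler_pM2l twopi_gt0).
    by rewrite le_max lexx orbT.
  rewrite /dyadic_mean; apply: le_circle_integral => //; first exact: measurable_ln_sq_dist1.
    by move=> x; rewrite le_max lexx.
  move=> x; rewrite ge_max M'/=.
  by have /andP[_ +] := C_bound p' q' (x *+ 2 ^ (0 + k)) pq'; lra.
have Jle k : ((2 ^+ k)%:E * dyadic_mean 0 p q M <= (pi *+ 2 * (2 ^+ k * M + C))%:E)%E.
  have [p' [q' [pq' M' ->]]] := dyadic_iter k 0 pq1 M0.
  rewrite -circle_integral_cst /dyadic_mean; apply: le_circle_integral => //.
    exact: measurable_ln_sq_dist1.
  by move=> x; have /andP[+ _] := C_bound p' q' (x *+ 2 ^ (0 + k)) pq'; lra.
have Jfin : dyadic_mean 0 p q M \is a fin_num.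
  have := Jge 0%N; have := Jle 0%N; rewrite expr0 mul1e => h1 h2.
  by rewrite fin_numE; apply/andP; split; apply/eqP => JE; move: h1 h2; rewrite JE.
rewrite -(fineK Jfin); congr (_%:E); apply/eqP; rewrite -subr_eq0 -normr_le0.
rewrite leNgt; apply/negP => d0.
move: d0; set j := fine _; set d := `|_| => d0.
(* 2^k d exceeds the uniform bound 2 pi C on 2^k times the defect *)
pose k := (Num.trunc (pi *+ 2 * C / d)).+1.
have kd : pi *+ 2 * C < 2 ^+ k * d.
  rewrite -ltr_pdivrMr//; apply: lt_trans (truncnS_gt _) _.
  by rewrite -natrX ltr_nat ltn_expl.
clearbody k; have := Jle k; have := Jge k; rewrite -(fineK Jfin) -/j -!EFinM !lee_fin => h1 h2.
move: kd; rewrite -[2 ^+ k](@ger0_norm _ (2 ^+ k)) ?exprn_ge0// /d -normrM.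
apply/negP; rewrite -leNgt ler_norml.
move: h1 h2; rewrite -/j; clear d0 d; move: (pi *+ 2) (2 ^+ k) j => T N j h1 h2.
by apply/andP; split; lra.
Qed.

End jensen_disk.

(** * The logarithmic kernel averaged over a great circle *)

Lemma measurable_ge0_inv d (T : measurableType d) (R : realType) (f : T -> R) :
  measurable_fun setT f -> (forall x, 0 <= f x) ->
  measurable_fun setT (fun x => (f x)^-1).
Proof.
move=> mf f0; rewrite (_ : (fun _ => _) = (fun x => f x `^ (-1))); last first.
  by apply/funext => x; rewrite powR_inv1.
exact: (measurableT_comp (measurable_powR (-1)) mf).
Qed.

Section great_circle.
Context {R : realType} (m : nat).
Local Notation n := m.+2.
Local Notation mu := (lebesgue_tuple R n).
Implicit Types (x y : n.-tuple R) (r t : R).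

(** A circle of radius r centred at the origin, in the plane of the first two
coordinates. A radial function is constant on it, and dilating it keeps it of
the same form; averaging over it stands in for averaging over a sphere. *)
Definition great_circle r t : n.-tuple R :=
  [tuple nth 0 [:: r * cos t; r * sin t] i | i < n].

Definition sq_planar_norm y : R := tnth y ord0 ^+ 2 + tnth y (lift ord0 ord0) ^+ 2.

Definition planar_ratio y : R := sq_planar_norm y / enorm y ^+ 2.

Lemma sq_enorm_split y : enorm y ^+ 2 =
  sq_planar_norm y + \sum_(i < m) tnth y (lift ord0 (lift ord0 i)) ^+ 2.
Proof. by rewrite sqr_enorm 2!big_ord_recl addrA. Qed.

Lemma sq_planar_norm_ge0 y : 0 <= sq_planar_norm y.
Proof. by rewrite addr_ge0 ?sqr_ge0. Qed.

Lemma sq_planar_norm_le y : sq_planar_norm y <= enorm y ^+ 2.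
Proof. by rewrite sq_enorm_split lerDl sumr_ge0// => i _; rewrite sqr_ge0. Qed.

Lemma planar_ratioE y : enorm y ^+ 2 * planar_ratio y = sq_planar_norm y.
Proof.
rewrite /planar_ratio mulrC; have [y0|y0] := eqVneq (enorm y ^+ 2) 0.
  rewrite y0 mulr0; apply/esym/eqP; rewrite eq_le sq_planar_norm_ge0 andbT -y0.
  exact: sq_planar_norm_le.
by rewrite divfK.
Qed.

Lemma planar_ratio01 y : 0 <= planar_ratio y <= 1.
Proof.
rewrite /planar_ratio divr_ge0 ?sq_planar_norm_ge0 ?sqr_ge0//=.
have [y0|y0] := eqVneq (enorm y ^+ 2) 0; first by rewrite y0 invr0 mulr0.
by rewrite ler_pdivrMr ?mul1r ?sq_planar_norm_le// lt_def y0 sqr_ge0.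
Qed.

Lemma planar_ratio_scale (s : R) y : 0 < s ->
  planar_ratio (tuple_scale s y) = planar_ratio y.
Proof.
move=> s0; rewrite /planar_ratio enorm_scale ?(ltW s0)// /sq_planar_norm !tnth_mktuple.
rewrite !exprMn -mulrDr invfM mulrACA divff ?mul1r//.
by rewrite expf_neq0// gt_eqF.
Qed.

Lemma measurable_planar_ratio : measurable_fun setT planar_ratio.
Proof.
rewrite /planar_ratio; apply: measurable_funM.
  by apply: measurable_funD; apply: measurable_funX; exact: measurable_tnth.
apply: measurable_ge0_inv; last by move=> y; exact: sqr_ge0.
by apply: measurable_funX; exact: measurable_enorm.
Qed.

Lemma enorm_great_circle r t : 0 <= r -> enorm (great_circle r t) = r.
Proof.
move=> r0; apply/eqP; rewrite -(@eqrXn2 _ 2)// ?enorm_ge0//; apply/eqP.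
rewrite sq_enorm_split big1; last by move=> i _; rewrite tnth_mktuple nth_default ?expr0n.
rewrite addr0 /sq_planar_norm !tnth_mktuple/= !exprMn -mulrDr cos2Dsin2 mulr1.
by [].
Qed.

Definition planar_dot y t : R := tnth y ord0 * cos t + tnth y (lift ord0 ord0) * sin t.

Lemma sqr_dist_great_circle r t y :
  enorm (tuple_sub (great_circle r t) y) ^+ 2 =
  r ^+ 2 + enorm y ^+ 2 - 2 * r * planar_dot y t.
Proof.
rewrite sq_enorm_split [X in _ = _ + X - _]sq_enorm_split.
rewrite (eq_bigr (fun i => tnth y (lift ord0 (lift ord0 i)) ^+ 2)); last first.
  by move=> i _; rewrite !tnth_mktuple nth_default ?sub0r ?sqrrN.
rewrite /sq_planar_norm /planar_dot !tnth_mktuple/=.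
have := cos2Dsin2 t; move: (cos t) (sin t) (\sum_(i < m) _) => c s S cs.
apply/eqP; rewrite -subr_eq0.
rewrite [X in X == 0](_ : _ = r ^+ 2 * (c ^+ 2 + s ^+ 2 - 1)); last ring.
by rewrite cs subrr mulr0.
Qed.

Lemma planar_dot_le y t : `|planar_dot y t| <= enorm y.
Proof.
rewrite -ler_sqr ?nnegrE ?enorm_ge0// real_normK ?num_real//.
apply: le_trans (sq_planar_norm_le y).
rewrite -[leRHS]mulr1 -(cos2Dsin2 t) /sq_planar_norm /planar_dot -subr_ge0.
set a := tnth _ _; set b := tnth _ _.
rewrite (_ : _ - _ = (a * sin t - b * cos t) ^+ 2); last ring.
exact: sqr_ge0.
Qed.

Lemma dist_great_circle_le r t y : 0 <= r ->
  enorm (tuple_sub (great_circle r t) y) <= r + enorm y.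
Proof.
move=> r0; rewrite -ler_sqr ?nnegrE ?enorm_ge0 ?addr_ge0 ?enorm_ge0//.
rewrite sqr_dist_great_circle.
have := planar_dot_le y t; rewrite ler_norml => /andP[h _]; nra.
Qed.

(** The bound does not depend on y: it makes Tonelli's theorem applicable to the
average over the circle. When x = y the kernel is ln 0 = 0. *)
Lemma log_kernel_great_circle_ge r t y : 0 <= r ->
  0 <= log_kernel (great_circle r t) y + ln (1 + r).
Proof.
move=> r0; have y0 := enorm_ge0 y; rewrite /log_kernel.
set d := enorm (tuple_sub _ _).
have l0 : 0 <= ln (1 + r) by apply: ln_ge0; lra.
have [d0|d0] := eqVneq d 0; first by rewrite d0 invr0 mulr0 ln0// add0r.
have {}d0 : 0 < d by rewrite lt_def d0 enorm_ge0.
rewrite -lnM ?posrE ?divr_gt0//; try lra.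
apply: ln_ge0; rewrite mulrAC ler_pdivlMr// mul1r.
by apply: le_trans (dist_great_circle_le _ _ r0) _; nra.
Qed.

Lemma log_mean_le r t y : 0 < r -> 0 <= t <= 1 ->
  0 <= ln (1 + enorm y) - log_mean r (enorm y) t + ln (1 + r).
Proof.
move=> r0 /andP[t0 t1]; have y0 := enorm_ge0 y; move: (enorm y) y0 => s s0.
have c0 := sq_geo_mean_gt0 s r0 t1.
suff : log_mean r s t <= ln (1 + s) + ln (1 + r) by lra.
rewrite /log_mean ler_pdivrMr// mulr_natr -lnM ?posrE; try lra.
rewrite -lnXn; last by rewrite mulr_gt0; lra.
rewrite ler_ln ?posrE ?exprn_gt0// ?mulr_gt0//; try lra.
apply: (@le_trans _ _ ((r + s) ^+ 2)); last by rewrite ler_sqr ?nnegrE; nra.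
rewrite /sq_geo_mean ler_pdivrMr//.
have : Num.sqrt ((r ^+ 2 + s ^+ 2) ^+ 2 - 4 * (r ^+ 2 * s ^+ 2 * t)) <= r ^+ 2 + s ^+ 2.
  rewrite -[leRHS]ger0_norm ?addr_ge0 ?sqr_ge0// -sqrtr_sqr ler_wsqrtr// gerBl.
  by rewrite mulr_ge0// mulr_ge0// mulr_ge0// sqr_ge0.
nra.
Qed.

End great_circle.

Section great_circle_mean.
Context {R : realType} (m : nat).
Local Notation n := m.+2.
Local Notation mu := (lebesgue_tuple R n).
Implicit Types (x y : n.-tuple R) (r t : R).

(** On the circle |x - y|^2 = c |1 - z|^2 with |z| < 1 and c the value of
sq_geo_mean, so Jensen's formula leaves ln c. The factorisation c (1 + |z|^2) =
r^2 + |y|^2 is the quadratic equation of c. The condition |y| <> r keeps z off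
the unit circle. *)
Lemma circle_integral_log_kernel r y : 0 < r -> enorm y != r ->
  circle_integral (fun t => log_kernel (great_circle m r t) y + ln (1 + r)) =
  (pi *+ 2 * (ln (1 + enorm y) - log_mean r (enorm y) (planar_ratio y) + ln (1 + r)))%:E.
Proof.
move=> r0 yr; have y0 := enorm_ge0 y.
have /andP[t0 t1] := planar_ratio01 y.
have c0 := sq_geo_mean_gt0 (enorm y) r0 t1.
have := sq_geo_mean_root (sqr_ge0 r) (sqr_ge0 (enorm y)) t1.
rewrite /log_mean; move: c0; set c := sq_geo_mean _ _ _ => c0 cE.
have cE' : c ^+ 2 = (r ^+ 2 + enorm y ^+ 2) * c - r ^+ 2 * sq_planar_norm y.
  by rewrite cE -mulrA planar_ratioE.
have cN0 : c != 0 by rewrite gt_eqF.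
pose p := r * tnth y ord0 / c; pose q := r * tnth y (lift ord0 ord0) / c.
have pqE : p ^+ 2 + q ^+ 2 = r ^+ 2 * sq_planar_norm y / c ^+ 2.
  by rewrite /p /q /sq_planar_norm; field.
have pq1 : p ^+ 2 + q ^+ 2 < 1.
  rewrite pqE ltr_pdivrMr ?exprn_gt0// mul1r.
  have half : r ^+ 2 + enorm y ^+ 2 <= 2 * c.
    by rewrite /c /sq_geo_mean mulrC divfK// lerDl sqrtr_ge0.
  apply: (@le_lt_trans _ _ (r ^+ 2 * enorm y ^+ 2)).
    by rewrite ler_wpM2l ?sqr_ge0// sq_planar_norm_le.
  apply: (@lt_le_trans _ _ (((r ^+ 2 + enorm y ^+ 2) / 2) ^+ 2)).
    rewrite -subr_gt0 (_ : _ - _ = ((r ^+ 2 - enorm y ^+ 2) / 2) ^+ 2); last by field.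
    rewrite exprn_even_gt0//= mulf_neq0 ?invr_eq0// subr_sqr mulf_neq0//.
      by rewrite subr_eq0 eq_sym.
    by rewrite gt_eqF// ltr_wpDr.
  rewrite ler_sqr ?nnegrE ?(ltW c0)//; last first.
    by rewrite divr_ge0// addr_ge0 ?sqr_ge0.
  by rewrite ler_pdivrMr// mulrC.
have distE t : enorm (tuple_sub (great_circle m r t) y) ^+ 2 = c * sq_dist1 p q t.
  rewrite sqr_dist_great_circle /sq_dist1 pqE.
  have -> : r ^+ 2 + enorm y ^+ 2 = c + r ^+ 2 * sq_planar_norm y / c.
    by apply: (mulIf cN0); rewrite [RHS]mulrDl divfK// -expr2 cE'; ring.
  by rewrite /planar_dot /p /q; field.
pose M := 2 * (ln (1 + enorm y) - ln c / 2 + ln (1 + r)).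
have lkE t : log_kernel (great_circle m r t) y + ln (1 + r) =
             2^-1 * (M - ln (sq_dist1 p q t)).
  have L0 := sq_dist1_gt0 t pq1.
  have d0 : 0 < enorm (tuple_sub (great_circle m r t) y).
    have : 0 < enorm (tuple_sub (great_circle m r t) y) ^+ 2.
      by rewrite distE mulr_gt0.
    by rewrite exprn_even_gt0//= => dN0; rewrite lt_def dN0 enorm_ge0.
  have := congr1 (@ln R) (distE t); rewrite lnXn// lnM ?posrE// => dE.
  rewrite /log_kernel ln_div ?posrE//; last lra.
  by rewrite /M; lra.
have M0 t : 0 <= M - ln (sq_dist1 p q t).
  have := log_kernel_great_circle_ge t y (ltW r0); rewrite lkE.
  by rewrite pmulr_rge0.
have mM : measurable_fun setT (fun t => M - ln (sq_dist1 p q t)).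
  rewrite (_ : (fun _ => _) = (fun t => M - ln (sq_dist1 p q (t *+ 1)))).
    exact: measurable_ln_sq_dist1.
  by apply/funext => t; rewrite mulr1n.
rewrite [LHS](_ : _ = (2^-1%:E * circle_integral (fun t => M - ln (sq_dist1 p q t))%R)%E).
  rewrite circle_integral_ln_sq_dist1// -EFinM; congr (_%:E).
  by rewrite /M; field.
rewrite /circle_integral -ge0_integralZl_EFin; first last.
- by rewrite invr_ge0.
- by apply: measurable_funTS; exact/measurable_EFinP.
- by move=> t _; rewrite lee_fin.
- exact: measurable_itv.
- by apply: eq_integral => t _; rewrite lkE EFinM.
Qed.

Lemma measurable_log_mean d (T : measurableType d) (f g k : T -> R) :
  measurable_fun setT f -> measurable_fun setT g -> measurable_fun setT k ->
  measurable_fun setT (fun z => log_mean (f z) (g z) (k z)).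
Proof.
move=> mf mg mk; apply: measurable_funM => //.
apply: (@measurableT_comp _ _ _ _ _ _ (@ln R) _
  (fun z => sq_geo_mean (f z ^+ 2) (g z ^+ 2) (k z))) => //.
apply: measurable_funM => //.
have mf2 := measurable_funX 2 mf; have mg2 := measurable_funX 2 mg.
apply: measurable_funD; first exact: measurable_funD.
apply: (@measurableT_comp _ _ _ _ _ _ (@Num.sqrt R) _
  (fun z => (f z ^+ 2 + g z ^+ 2) ^+ 2 - 4 * (f z ^+ 2 * g z ^+ 2 * k z))).
  exact: continuous_measurable_fun (@sqrt_continuous R).
apply: measurable_funB.
  by apply: measurable_funX; exact: measurable_funD.
by apply: measurable_funM => //; apply: measurable_funM => //; exact: measurable_funM.
Qed.

Lemma measurable_log_kernel_comp d (T : measurableType d) (f g : T -> n.-tuple R) :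
  measurable_fun setT f -> measurable_fun setT g ->
  measurable_fun setT (fun z => log_kernel (f z) (g z)).
Proof.
move=> mf mg; apply: (@measurableT_comp _ _ _ _ _ _ (@ln R) _
  (fun z => (1 + enorm (g z)) / enorm (tuple_sub (f z) (g z)))) => //.
apply: measurable_funM.
  by apply: measurable_funD => //; exact: measurableT_enorm.
apply: measurable_ge0_inv; last by move=> z; exact: enorm_ge0.
apply: measurableT_enorm; apply/measurable_fun_tnthP => i.
rewrite (_ : _ \o _ = (fun z => tnth (f z) i - tnth (g z) i)); last first.
  by apply/funext => z /=; rewrite tnth_mktuple.
apply: measurable_funB.
  exact: (measurableT_comp (measurable_tnth i) mf).
exact: (measurableT_comp (measurable_tnth i) mg).
Qed.

Lemma measurable_great_circle r : measurable_fun setT (great_circle m r).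
Proof.
apply/measurable_fun_tnthP => i.
rewrite (_ : _ \o _ = (fun t => nth 0 [:: r * cos t; r * sin t] i)); last first.
  by apply/funext => z /=; rewrite tnth_mktuple.
case: i => -[|[|k]] ik /=.
- apply: measurable_funM => //.
  exact: continuous_measurable_fun (@continuous_cos R).
- apply: measurable_funM => //.
  exact: continuous_measurable_fun (@continuous_sin R).
- by rewrite (_ : (fun _ => _) = cst 0)//; apply/funext => t; rewrite nth_nil.
Qed.

End great_circle_mean.

(** * Potentials that are constant on a great circle *)

Section potential.
Context {R : realType} (m : nat).
Local Notation n := m.+2.
Local Notation mu := (lebesgue_tuple R n).
Implicit Types (x y : n.-tuple R) (r t : R).

(** The average of log_kernel x y over the x of the great circle of radius r, for
|y| <> r. *)
Definition mean_kernel r y : R :=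
  ln (1 + enorm y) - log_mean r (enorm y) (planar_ratio y).

Lemma measurable_mean_kernel r : measurable_fun setT (mean_kernel r).
Proof.
apply: measurable_funB; last first.
  apply: measurable_log_mean => //; first exact: measurable_enorm.
  exact: measurable_planar_ratio.
apply: (@measurableT_comp _ _ _ _ _ _ (@ln R) _ (fun y : n.-tuple R => 1 + enorm y)) => //.
by apply: measurable_funD => //; exact: measurable_enorm.
Qed.

(** A potential that is constant on the circle equals its average there, and by
Tonelli's theorem that average is the potential of the averaged kernel. The
points y with |y| = r, where the average is not computed, form a null set. *)
Lemma great_circle_potential (F : n.-tuple R -> R) r V0 : 0 < r ->
  (forall y, 0 <= F y) -> mu.-integrable setT (EFin \o F) ->
  (forall t, mu.-integrable setT (fun y => (log_kernel (great_circle m r t) y * F y)%:E)) ->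
  (forall t, \int[mu]_y (log_kernel (great_circle m r t) y * F y) = V0) ->
  mu.-integrable setT (fun y => (mean_kernel r y * F y)%:E) /\
  \int[mu]_y (mean_kernel r y * F y) = V0.
Proof.
move=> r0 F0 iF ikF kF.
have mF : measurable_fun setT F by apply/measurable_EFinP; exact: measurable_int iF.
pose C := ln (1 + r).
pose MF := \int[mu]_y F y.
have iCF : mu.-integrable setT (fun y => (C * F y)%:E).
  by under eq_fun do rewrite EFinM; exact: integrableZl.
pose G (p : R * n.-tuple R) := (log_kernel (great_circle m r p.1) p.2 + C) * F p.2.
have G0 p : 0 <= G p.
  by rewrite mulr_ge0// log_kernel_great_circle_ge// ltW.
have mG : measurable_fun setT G.
  apply: measurable_funM; last exact: (measurableT_comp mF measurable_snd).
  apply: measurable_funD => //; apply: measurable_log_kernel_comp => //.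
  apply: (@measurableT_comp _ _ _ _ _ _ (great_circle m r) _ fst) => //.
  exact: measurable_great_circle.
have intG t : (\int[mu]_y (G (t, y))%:E = (V0 + C * MF)%:E)%E.
  rewrite /G/=; under eq_integral do rewrite mulrDl EFinD.
  rewrite integralD//.
  rewrite EFinD; congr (_ + _)%E.
    by rewrite -(kF t) /Rintegral fineK//; exact: integrable_fin_num (ikF t).
  under eq_integral do rewrite EFinM.
  rewrite integralZl// EFinM; congr (_ * _)%E.
  by rewrite /MF /Rintegral fineK//; exact: integrable_fin_num iF.
pose H y := (mean_kernel r y + C) * F y.
have H0 y : 0 <= H y.
  by rewrite mulr_ge0// /mean_kernel log_mean_le// planar_ratio01.
have mH : measurable_fun setT H.
  by apply: measurable_funM => //; apply: measurable_funD => //; exact: measurable_mean_kernel.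
pose I := `[0%R, (pi *+ 2)%R[%classic : set R.
pose GI (p : R * n.-tuple R) := ((fun p => (G p)%:E) \_ (I `*` setT)) p.
have mI : measurable I by exact: measurable_itv.
have mGI : measurable_fun setT GI.
  apply/(measurable_restrictT _ (measurableX mI measurableT)).
  by apply: measurable_funTS; exact/measurable_EFinP.
have GI0 p : (0 <= GI p)%E by rewrite /GI erestrict_ge0// => q _; rewrite lee_fin.
have int1 : (\int[lebesgue_measure]_t \int[mu]_y GI (t, y) =
             (pi *+ 2 * (V0 + C * MF))%:E)%E.
  rewrite -circle_integral_cst /circle_integral [RHS]integral_mkcond.
  apply: eq_integral => t _; rewrite patchE; case: ifPn => tI.
    rewrite -(intG t); apply: eq_integral => y _.
    by rewrite /GI patchE in_setX tI in_setT.
  apply: integral0_eq => y _; by rewrite /GI patchE in_setX (negbTE tI).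
have int2 : (\int[mu]_y \int[lebesgue_measure]_t GI (t, y) =
             \int[mu]_y (pi *+ 2 * H y)%:E)%E.
  apply: ge0_ae_eq_integral => //.
  - exact: (measurable_fun_fubini_tonelli_G (m1 := lebesgue_measure) GI).
  - by apply/measurable_EFinP; exact: measurable_funM.
  - by move=> y _; exact: integral_ge0.
  - by move=> y _; rewrite lee_fin mulr_ge0// ltW// twopi_gt0.
  exists [set y | enorm y = r]; split.
  - exact: (measurable_preimage_enorm (A := [set r])).
  - exact: lebesgue_tuple_sphere.
  move=> y /= yr; apply/eqP; apply: contra_notT yr => yr _.
  rewrite (_ : (\int[_]_t _)%E =
    (circle_integral (fun t => log_kernel (great_circle m r t) y + ln (1 + r))%R *
     (F y)%:E)%E).
    by rewrite circle_integral_log_kernel// -EFinM mulrA.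
  rewrite muleC /circle_integral -ge0_integralZl_EFin//; first last.
  - apply: measurable_funTS; apply/measurable_EFinP; apply: measurable_funD => //.
    apply: measurable_log_kernel_comp => //; exact: measurable_great_circle.
  - by move=> t _; rewrite lee_fin log_kernel_great_circle_ge// ltW.
  rewrite [RHS]integral_mkcond; apply: eq_integral => t _.
  rewrite /GI !patchE in_setX in_setT andbT; case: ifPn => // _.
  by rewrite /G/= -EFinM mulrC.
have intH : (\int[mu]_y (H y)%:E = (V0 + C * MF)%:E)%E.
  have := fubini_tonelli (m1 := lebesgue_measure) (m2 := mu) GI mGI GI0.
  rewrite int1 int2; under [in RHS]eq_integral do rewrite EFinM.
  rewrite ge0_integralZl_EFin//; last 3 first.
  - by move=> y _; rewrite lee_fin.
  - exact/measurable_EFinP.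
  - by rewrite ltW// twopi_gt0.
  rewrite EFinM => /esym /(congr1 (fun z => ((pi *+ 2)^-1%:E * z)%E)).
  by rewrite !muleA -EFinM mulVf ?mul1e// gt_eqF// twopi_gt0.
have iH : mu.-integrable setT (EFin \o H).
  apply/integrableP; split; first exact/measurable_EFinP.
  rewrite (_ : (\int[_]_x _)%E = (V0 + C * MF)%:E) ?ltry// -intH.
  by apply: eq_integral => y _ /=; rewrite ger0_norm.
have kE : (fun y => (mean_kernel r y * F y)%:E) =
          (fun y => (EFin \o H) y - (C * F y)%:E)%E.
  by apply/funext => y; rewrite /H/= -EFinB; congr (_%:E); ring.
have ik : mu.-integrable setT (fun y => (mean_kernel r y * F y)%:E).
  by rewrite kE; exact: integrableB.
split=> //; rewrite /Rintegral kE integralB//=.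
rewrite intH; under [X in (_ - X)%E]eq_integral do rewrite EFinM.
rewrite integralZl//= -[X in (_ * X)%E]fineK; last exact: integrable_fin_num iF.
by rewrite -/(Rintegral _ _ _) -/MF /= addrK.
Qed.

End potential.

(** * Products of integrable functions *)

Section integrable_lemmas.
Context {R : realType}.

Lemma integrable_mul_bounded d (T : measurableType d)
    (mu : {measure set T -> \bar R}) (f h : T -> R) (c : R) :
  mu.-integrable setT (EFin \o f) -> measurable_fun setT h ->
  (forall x, `|h x| <= c) ->
  mu.-integrable setT (fun x => (f x * h x)%:E).
Proof.
move=> iff mh hc.
have mf : measurable_fun setT f by apply/measurable_EFinP; exact: measurable_int iff.
apply: (@le_integrable _ _ _ mu _ _ _ (fun x => (c * `|f x|)%:E)) => //.
- by apply/measurable_EFinP; exact: measurable_funM.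
- move=> x _; rewrite /= lee_fin !normrM normr_id mulrC.
  by apply: ler_wpM2r => //; exact: le_trans (hc x) (ler_norm _).
- under eq_fun do rewrite EFinM.
  by apply: integrableZl => //; exact: (integrable_norm iff).
Qed.

Lemma integrable_tensor d1 d2 (T1 : measurableType d1) (T2 : measurableType d2)
    (mu1 : {sigma_finite_measure set T1 -> \bar R})
    (mu2 : {sigma_finite_measure set T2 -> \bar R}) (a : T1 -> R) (b : T2 -> R) :
  mu1.-integrable setT (EFin \o a) -> mu2.-integrable setT (EFin \o b) ->
  (mu1 \x mu2)%E.-integrable setT (EFin \o (fun p => a p.1 * b p.2)) /\
  \int[(mu1 \x mu2)%E]_p (a p.1 * b p.2) = (\int[mu1]_x a x) * (\int[mu2]_y b y).
Proof.
move=> ia ib.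
have ma : measurable_fun setT a by apply/measurable_EFinP; exact: measurable_int ia.
have mb : measurable_fun setT b by apply/measurable_EFinP; exact: measurable_int ib.
have mab : measurable_fun setT (EFin \o (fun p : T1 * T2 => a p.1 * b p.2)).
  apply/measurable_EFinP; apply: measurable_funM.
    exact: (measurableT_comp ma measurable_fst).
  exact: (measurableT_comp mb measurable_snd).
have iab : (mu1 \x mu2)%E.-integrable setT (EFin \o (fun p => a p.1 * b p.2)).
  apply/(integrable12ltyP _ _ mab) => /=.
  under eq_integral => x _.
    under eq_integral do rewrite normrM EFinM.
    rewrite ge0_integralZl_EFin//; last first.
      by apply/measurable_EFinP; exact: measurableT_comp.
    over.
  have [_ bfin] := integrableP _ _ _ ib.
  have [_ afin] := integrableP _ _ _ ia.
  have bE : (\int[mu2]_y (`|b y|)%:E)%E \is a fin_num.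
    by rewrite ge0_fin_numE// integral_ge0// => y _; rewrite lee_fin.
  rewrite -(fineK bE).
  rewrite ge0_integralZr//; last 2 first.
  - by apply/measurable_EFinP; exact: measurableT_comp.
  - by rewrite lee_fin fine_ge0// integral_ge0// => y _; rewrite lee_fin.
  by rewrite fineK// lte_mul_pinfty// ?ge0_fin_numE ?integral_ge0// => y _; rewrite lee_fin.
split=> //.
rewrite /Rintegral -(integral12_prod_meas1 iab)/=.
have -> : (fun x => (\int[mu2]_y (a x * b y)%:E)%E) =
          (fun x => (a x)%:E * (\int[mu2]_y (b y)%:E))%E.
  by apply/funext => x; under eq_integral do rewrite EFinM; rewrite integralZl.
rewrite -(fineK (integrable_fin_num measurableT ib)) integralZr//=.
by rewrite fineM// ?(integrable_fin_num measurableT ib) ?(integrable_fin_num measurableT ia).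
Qed.

End integrable_lemmas.

(** * The bilinear form of the radial increments *)

Section pairing.
Context {R : realType} (m : nat).
Local Notation n := m.+2.
Local Notation mu := (lebesgue_tuple R n).
Local Notation P := (lebesgue_tuple R n \x lebesgue_tuple R n)%E.
Implicit Types (x y : n.-tuple R) (a b : n.-tuple R -> R) (h : R).

Definition mean_diff h (p : n.-tuple R * n.-tuple R) : R :=
  log_mean_diff h (enorm p.1) (enorm p.2) (planar_ratio p.2).

(** For the density b of a radial potential v, the inner integral over y is, up to
a constant, the increment v (e^(-h) |x|) - v |x|; the form integrates it
against a. *)
Definition pairing a b h : R := \int[P]_p (a p.1 * b p.2 * mean_diff h p).

Lemma measurable_log_mean_diff d (T : measurableType d) h (f g k : T -> R) :
  measurable_fun setT f -> measurable_fun setT g -> measurable_fun setT k ->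
  measurable_fun setT (fun z => log_mean_diff h (f z) (g z) (k z)).
Proof.
move=> mf mg mk; apply: measurable_funB; first exact: measurable_log_mean.
by apply: measurable_log_mean => //; exact: measurable_funM.
Qed.

Lemma measurable_enorm_fst : measurable_fun setT (fun p : n.-tuple R * n.-tuple R => enorm p.1).
Proof. exact: measurableT_enorm. Qed.

Lemma measurable_enorm_snd : measurable_fun setT (fun p : n.-tuple R * n.-tuple R => enorm p.2).
Proof. exact: measurableT_enorm. Qed.

Lemma measurable_planar_ratio_snd :
  measurable_fun setT (fun p : n.-tuple R * n.-tuple R => planar_ratio p.2).
Proof.
apply: (@measurableT_comp _ _ _ _ _ _ (@planar_ratio R m) _ snd) => //.
exact: measurable_planar_ratio.
Qed.

Lemma measurable_mean_diff h : measurable_fun setT (mean_diff h).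
Proof.
apply: measurable_log_mean_diff.
- exact: measurable_enorm_fst.
- exact: measurable_enorm_snd.
- exact: measurable_planar_ratio_snd.
Qed.

Lemma norm_mean_diff h p : `|mean_diff h p| <= `|h|.
Proof. by apply: norm_log_mean_diff; rewrite ?enorm_ge0 ?planar_ratio01. Qed.

Lemma integrable_pairing a b h : mu.-integrable setT (EFin \o a) ->
  mu.-integrable setT (EFin \o b) ->
  P.-integrable setT (fun p => (a p.1 * b p.2 * mean_diff h p)%:E).
Proof.
move=> ia ib; have [iab _] := integrable_tensor ia ib.
exact: (integrable_mul_bounded iab (measurable_mean_diff h) (norm_mean_diff h)).
Qed.

Lemma pairing_fubini a b h : mu.-integrable setT (EFin \o a) ->
  mu.-integrable setT (EFin \o b) ->
  (\int[mu]_x \int[mu]_y (a x * b y * mean_diff h (x, y))%:E = (pairing a b h)%:E)%E.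
Proof.
move=> ia ib; have iab := integrable_pairing h ia ib.
rewrite /pairing /Rintegral fineK; last exact: integrable_fin_num iab.
by rewrite -(integral12_prod_meas1 iab).
Qed.

Section radial_weight.
Variable W : R -> R.
Hypothesis mW : measurable_fun setT W.
Hypothesis W_ge0 : forall r, 0 <= W r.
Let w x := W (enorm x).
Hypothesis iw : mu.-integrable setT (EFin \o w).

Let mw : measurable_fun setT w.
Proof. by apply/measurable_EFinP; exact: measurable_int iw. Qed.

Definition mean_diff_swap h (p : n.-tuple R * n.-tuple R) : R :=
  log_mean_diff h (enorm p.2) (enorm p.1) (planar_ratio p.2).

Lemma measurable_mean_diff_swap h : measurable_fun setT (mean_diff_swap h).
Proof.
apply: measurable_log_mean_diff.
- exact: measurable_enorm_snd.
- exact: measurable_enorm_fst.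
- exact: measurable_planar_ratio_snd.
Qed.

Lemma norm_mean_diff_swap h p : `|mean_diff_swap h p| <= `|h|.
Proof. by apply: norm_log_mean_diff; rewrite ?enorm_ge0 ?planar_ratio01. Qed.

Lemma integrable_weight2 : P.-integrable setT (EFin \o (fun p => w p.1 * w p.2)).
Proof. by have [] := integrable_tensor iw iw. Qed.

Lemma integrable_pairing_swap h :
  P.-integrable setT (fun p => (w p.1 * w p.2 * mean_diff_swap h p)%:E).
Proof.
exact: (integrable_mul_bounded integrable_weight2 (measurable_mean_diff_swap h)
  (norm_mean_diff_swap h)).
Qed.

(** radius_swap applies to the kernel shifted by |h|, which makes it nonnegative. *)
Lemma pairing_swap h :
  pairing w w h = \int[P]_p (w p.1 * w p.2 * mean_diff_swap h p).
Proof.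
pose Phi (q : R * R * R) : \bar R :=
  (W q.1.1 * W q.1.2 * Num.max 0 (log_mean_diff h q.1.1 q.1.2 q.2 + `|h|))%:E.
have m11 : measurable_fun setT (fun q : R * R * R => q.1.1) by exact: measurableT_comp.
have m12 : measurable_fun setT (fun q : R * R * R => q.1.2) by exact: measurableT_comp.
have mPhi : measurable_fun setT Phi.
  apply/measurable_EFinP; apply: measurable_funM.
    by apply: measurable_funM; exact: (measurableT_comp mW).
  apply: measurable_maxr => //; apply: measurable_funD => //.
  exact: measurable_log_mean_diff.
have Phi0 q : (0 <= Phi q)%E.
  by rewrite lee_fin mulr_ge0// ?mulr_ge0// le_max lexx.
have shift (k : n.-tuple R * n.-tuple R -> R) : measurable_fun setT k ->
    (forall p, `|k p| <= `|h|) ->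
    (\int[mu]_x \int[mu]_y (w x * w y * Num.max 0 (k (x, y) + `|h|))%:E)%E =
    ((\int[P]_p (w p.1 * w p.2 * k p)) + `|h| * \int[P]_p (w p.1 * w p.2))%:E.
  move=> mk kh; have ik := integrable_mul_bounded integrable_weight2 mk kh.
  have ih : P.-integrable setT (fun p => (`|h| * (w p.1 * w p.2))%:E).
    by under eq_fun do rewrite EFinM; exact: integrableZl integrable_weight2.
  rewrite -RintegralZl//; last exact: integrable_weight2.
  rewrite -RintegralD// /Rintegral.
  have E p : (w p.1 * w p.2 * k p + `|h| * (w p.1 * w p.2))%:E =
             (w p.1 * w p.2 * Num.max 0 (k p + `|h|))%:E.
    have := kh p; rewrite ler_norml => /andP[kh1 _].
    by rewrite max_r; [congr (_%:E); ring|lra].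
  have i1 : P.-integrable setT (fun p => (w p.1 * w p.2 * Num.max 0 (k p + `|h|))%:E).
    under eq_fun do rewrite -E EFinD; exact: integrableD.
  under eq_integral do rewrite E.
  rewrite fineK; last exact: integrable_fin_num i1.
  by rewrite -(integral12_prod_meas1 i1).
have S1 := shift _ (measurable_mean_diff h) (norm_mean_diff h).
have S2 := shift _ (measurable_mean_diff_swap h) (norm_mean_diff_swap h).
apply: (@addIr _ (`|h| * \int[P]_p (w p.1 * w p.2))); apply: EFin_inj.
apply: (etrans (esym S1)); apply: etrans S2; clear S1.
transitivity (\int[mu]_x \int[mu]_y Phi (enorm x, enorm y, planar_ratio y))%E.
  by apply: eq_integral => x _; apply: eq_integral => y _.
have H := radius_swap (@measurable_planar_ratio R m) (@planar_ratio_scale R m) mPhi Phi0.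
apply: (etrans H); clear H; apply: eq_integral => x _; apply: eq_integral => y _.
by rewrite /Phi /w/= [W (enorm y) * _]mulrC.
Qed.

End radial_weight.
End pairing.

(** * The form on the diagonal *)

Section pairing_limits.
Context {R : realType} (m : nat).
Local Notation n := m.+2.
Local Notation mu := (lebesgue_tuple R n).
Local Notation P := (lebesgue_tuple R n \x lebesgue_tuple R n)%E.
Implicit Types (x y : n.-tuple R) (h : R).

(** Spheres are null sets. *)
Lemma generic_radii_ae :
  {ae P, forall p, [/\ 0 < enorm p.1, 0 < enorm p.2 & enorm p.1 != enorm p.2]}.
Proof.
pose N1 := [set p : n.-tuple R * n.-tuple R | enorm p.1 - enorm p.2 = 0].
pose N2 := [set x : n.-tuple R | enorm x = 0] `*` [set: n.-tuple R].
pose N3 := [set: n.-tuple R] `*` [set x : n.-tuple R | enorm x = 0].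
have mS : measurable [set x : n.-tuple R | enorm x = 0].
  exact: (measurable_preimage_enorm (A := [set 0])).
have mN1 : measurable N1.
  rewrite /N1 -[X in measurable X]setTI.
  have mD := measurable_funB (@measurable_enorm_fst R m) (@measurable_enorm_snd R m).
  exact: (mD measurableT [set 0] (measurable_set1 0)).
have mN2 : measurable N2 by exact: measurableX.
have mN3 : measurable N3 by exact: measurableX.
have P1 : P N1 = 0%E.
  apply: integral0_eq => x _ /=.
  rewrite (_ : xsection _ _ = [set y | enorm y = enorm x]).
    exact: lebesgue_tuple_sphere.
  rewrite /xsection; apply/seteqP; split => y /=; rewrite inE /N1/=.
    by move=> /eqP; rewrite subr_eq0 => /eqP.
  by move=> ->; rewrite subrr.
have S0 := @lebesgue_tuple_sphere R n 0 (ltn0Sn _).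
have P2 : P N2 = 0%E.
  by rewrite product_measure1E// [X in (X * _)%E]S0 mul0e.
have P3 : P N3 = 0%E.
  by rewrite product_measure1E// [X in (_ * X)%E]S0 mule0.
have mN12 : measurable (N1 `|` N2) by exact: measurableU.
exists (N1 `|` N2 `|` N3); split.
- exact: measurableU.
- exact: (null_set_setU mN12 mN3 (null_set_setU mN1 mN2 P1 P2) P3).
move=> p /= H; apply: contrapT => /not_orP [/not_orP [H1 H2] H3]; apply: H.
rewrite !lt_def !enorm_ge0 !andbT; split; apply/eqP.
- by move=> p0; apply: H2.
- by move=> p0; apply: H3.
- by move=> p12; apply: H1; rewrite /N1/= p12 subrr.
Qed.

Section radial_weight.
Variable W : R -> R.
Hypothesis mW : measurable_fun setT W.
Hypothesis W_ge0 : forall r, 0 <= W r.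
Let w x := W (enorm x).
Hypothesis iw : mu.-integrable setT (EFin \o w).

(** By pairing_swap, twice the form is the integral of the symmetrised increment,
which is asymptotic to h and at most 2 |h| in absolute value; dominated
convergence applies. This is the integrated form of the identity
K(x, y) + K(y, x) = 1 for K(x, y) = x . (x - y) / |x - y|^2. *)
Lemma pairing_cvg (u : R^nat) : (forall k, u k != 0) -> u k @[k --> \oo] --> 0 ->
  pairing w w (u k) / u k @[k --> \oo] --> (\int[mu]_x w x) ^+ 2 / 2.
Proof.
move=> u_neq0 u_cvg0.
have [iww wwE] := integrable_tensor iw iw.
have mww := measurable_int _ iww.
pose q k (p : n.-tuple R * n.-tuple R) :=
  (mean_diff (u k) p + mean_diff_swap (u k) p) / u k.
pose f_ k p := (w p.1 * w p.2 * q k p)%:E.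
have mq k : measurable_fun setT (q k).
  apply: measurable_funM => //; apply: measurable_funD.
    exact: measurable_mean_diff.
  exact: measurable_mean_diff_swap.
have q2 k p : `|q k p| <= 2.
  rewrite /q normrM normfV ler_pdivrMr ?normr_gt0//.
  apply: le_trans (ler_normD _ _) _; rewrite mulr_natl mulr2n.
  by apply: lerD; [exact: norm_mean_diff|exact: norm_mean_diff_swap].
have if_ k : P.-integrable setT (f_ k) by exact: integrable_mul_bounded (q2 k).
have int_f k : (\int[P]_p f_ k p = (2 * (pairing w w (u k) / u k))%:E)%E.
  have i1 := integrable_pairing (u k) iw iw.
  have i2 := integrable_pairing_swap iw (u k).
  rewrite -(fineK (integrable_fin_num measurableT (if_ k))); congr (_%:E).
  have -> : fine (\int[P]_p f_ k p) =
      \int[P]_p ((u k)^-1 * (w p.1 * w p.2 * mean_diff (u k) p +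
                             w p.1 * w p.2 * mean_diff_swap (u k) p)).
    rewrite /Rintegral; congr fine; apply: eq_integral => p _.
    by rewrite /f_ /q; congr (_%:E); ring.
  rewrite RintegralZl//; last first.
    exact: (integrableD measurableT i1 i2).
  rewrite (RintegralD measurableT i1 i2) -(pairing_swap mW W_ge0 iw) -/(pairing w w (u k)); ring.
have q_cvg : {ae P, forall p, setT p -> f_ ^~ p @ \oo --> ((w p.1 * w p.2)%:E)%E}.
  apply: filterS generic_radii_ae => p [p1 p2 p12] _.
  apply: cvg_EFin; first by near=> k.
  rewrite -[X in _ --> X]mulr1; apply: cvgM; first exact: cvg_cst.
  rewrite /q /mean_diff /mean_diff_swap.
  apply: log_mean_diff_swap_cvg => //.
  by have /andP[] := planar_ratio01 p.2.
have ig : P.-integrable setT (fun p => (2 * (w p.1 * w p.2))%:E).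
  by under eq_fun do rewrite EFinM; exact: integrableZl iww.
have fg : {ae P, forall p k, setT p -> (`|f_ k p| <= (2 * (w p.1 * w p.2))%:E)%E}.
  apply: aeW => p k _; have ww0 : 0 <= w p.1 * w p.2 by apply: mulr_ge0; exact: W_ge0.
  by rewrite /f_ lee_fin normrM (ger0_norm ww0) mulrC; exact: (ler_wpM2r ww0 (q2 k p)).
have [_ _ DC] := dominated_convergence measurableT
  (fun k => measurable_int _ (if_ k)) mww q_cvg ig fg.
have DC1 : (2 * (pairing w w (u k) / u k))%:E @[k --> \oo] -->
    ((\int[mu]_x w x) ^+ 2)%:E.
  have -> : ((\int[mu]_x w x) ^+ 2)%:E = (\int[P]_p (w p.1 * w p.2)%:E)%E.
    by rewrite expr2 -wwE /Rintegral fineK//; exact: integrable_fin_num iww.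
  by under eq_fun do rewrite -int_f.
have /fine_cvgP[_ DC2] := DC1.
rewrite [X in _ --> X]mulrC.
have DC3 : 2^-1 * (2 * (pairing w w (u k) / u k)) @[k --> \oo] -->
    2^-1 * (\int[mu]_x w x) ^+ 2 by apply: cvgM; [exact: cvg_cst|exact: DC2].
by apply: cvg_trans DC3; apply: near_eq_cvg; near=> k; field.
Unshelve. all: by end_near. Qed.

End radial_weight.
End pairing_limits.

(** * Rigidity of the form *)

Section pairing_rigidity.
Context {R : realType} (m : nat).
Local Notation n := m.+2.
Local Notation mu := (lebesgue_tuple R n).
Local Notation P := (lebesgue_tuple R n \x lebesgue_tuple R n)%E.
Implicit Types (x y : n.-tuple R) (h : R).

Lemma measurable_exterior (a : R) : measurable [set x : n.-tuple R | a < enorm x].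
Proof.
rewrite (_ : [set _ | _] = [set x | (`]a, +oo[%classic : set R) (enorm x)]).
  exact: measurable_preimage_enorm.
by apply/seteqP; split => x /=; rewrite in_itv/= andbT.
Qed.

(** Otherwise the balls of radii c and 2 c would have the same volume for large
c. *)
Lemma lebesgue_tuple_exterior (a : R) : mu [set x | a < enorm x] != 0%E.
Proof.
apply/eqP => E0.
pose c := `|a| + 1; have c0 : 0 < c by rewrite ltr_wpDl.
have B0 := @lebesgue_tuple_ball_gt0 R n 1 ltr01.
have Boo := @lebesgue_tuple_ball_lty R n 1.
pose b := fine (mu [set x | enorm x < 1]).
have bE : mu [set x | enorm x < 1] = b%:E by rewrite fineK// ge0_fin_numE// ltW.
have b0 : 0 < b by rewrite -lte_fin -bE.
have : (mu [set x | (enorm x < 2 * c)%R] <= mu [set x | (enorm x < c)%R])%E.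
  rewrite -[leRHS]adde0 -E0.
  have mc := @measurable_enorm_lt R n c.
  apply: le_trans (measureU2 mu mc (measurable_exterior a)).
  apply: le_measure; rewrite ?inE; first exact: measurable_enorm_lt.
    by apply: measurableU => //; exact: measurable_exterior.
  move=> x /= _; have [xc|xc] := ltP (enorm x) c; first by left.
  by right; rewrite /= (lt_le_trans _ xc)// /c (le_lt_trans (ler_norm _))// ltrDl.
have c20 : 0 < 2 * c by rewrite mulr_gt0.
rewrite (lebesgue_tuple_ball _ c20) (lebesgue_tuple_ball _ c0).
rewrite bE -!EFinM lee_fin ler_pM2r// exprMn leNgt => /negP; apply.
by rewrite ltr_pMl ?exprn_gt0// exprn_egt1// ltr1n.
Qed.

Section radial_weight.
Variable W : R -> R.
Hypothesis mW : measurable_fun setT W.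
Hypothesis W_ge0 : forall r, 0 <= W r.
Let w x := W (enorm x).
Hypothesis iw : mu.-integrable setT (EFin \o w).
Variable G : n.-tuple R -> R.
Hypothesis G_ge0 : forall y, 0 <= G y.
Hypothesis iG : mu.-integrable setT (EFin \o G).

Let A : set (n.-tuple R * n.-tuple R) := [set p | expR 1 * enorm p.2 < enorm p.1].

Let mA : measurable A.
Proof.
pose f (p : n.-tuple R * n.-tuple R) := enorm p.1 - expR 1 * enorm p.2.
have mf : measurable_fun setT f.
  apply: measurable_funB; first exact: measurable_enorm_fst.
  by apply: measurable_funM => //; exact: measurable_enorm_snd.
rewrite (_ : A = setT `&` f @^-1` `]0, +oo[%classic).
  by apply: mf => //; exact: measurable_itv.
by rewrite setTI; apply/seteqP; split => p; rewrite /A /f/= in_itv/= andbT subr_gt0.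
Qed.

Let k (p : n.-tuple R * n.-tuple R) : R := w p.1 * G p.2 * \1_A p.

Let k_ge0 p : 0 <= k p.
Proof. by rewrite /k mulr_ge0// mulr_ge0// W_ge0. Qed.

Let ik : P.-integrable setT (EFin \o k).
Proof.
have [iwG _] := integrable_tensor iw iG.
have m1A : measurable_fun setT (\1_A : _ -> R) by exact: measurable_indic.
have A1 p : `|\1_A p : R| <= 1.
  by rewrite indicE; case: (_ \in _); rewrite ?normr1 ?normr0.
exact: (integrable_mul_bounded iwG m1A A1).
Qed.

(** By log_mean_diff_half: when e |y| < |x| and h <= 1, the point y lies in the ball
of radius e^(-h) |x|. *)
Lemma pairing_lower h : 0 <= h <= 1 ->
  h / 2 * \int[P]_p k p <= pairing w G h.
Proof.
move=> /andP[h0 h1]; rewrite -RintegralZl//; apply: le_Rintegral => //.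
- exact: (integrableZl measurableT (h / 2) ik).
- exact: integrable_pairing.
move=> p _; rewrite /k mulrCA; apply: ler_wpM2l.
  by rewrite mulr_ge0// W_ge0.
have t01 := planar_ratio01 p.2.
have /andP[d0 _] := log_mean_diff_ge0 h0 (enorm_ge0 p.1) (enorm_ge0 p.2) t01.
rewrite indicE; case: (boolP (p \in A)) => [|_]; last by rewrite mulr0.
rewrite inE /A/= mulr1 => pA.
apply: log_mean_diff_half; rewrite ?enorm_ge0//.
- apply: le_lt_trans pA; rewrite mulr_ge0 ?expR_ge0 ?enorm_ge0//.
- by have /andP[] := t01.
rewrite expRN ler_pdivlMl ?expR_gt0//; apply: le_trans (ltW pA).
by rewrite ler_wpM2r ?enorm_ge0// ler_expR.
Qed.

(** Every y with G y > 0 sees a set of positive measure of points x with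
e |y| < |x|, on which the weight is positive. *)
Lemma pairing_rigidity : (forall r, 0 < r -> 0 < W r) -> \int[P]_p k p <= 0 ->
  {ae mu, forall y, G y = 0}.
Proof.
move=> W_gt0 k_le0.
have k0 : (\int[P]_p (k p)%:E = 0)%E.
  rewrite -(fineK (integrable_fin_num measurableT ik)); congr (_%:E).
  by apply/eqP; rewrite eq_le k_le0/= fine_ge0// integral_ge0// => p _; rewrite lee_fin.
have mk : measurable_fun setT (EFin \o k) := measurable_int _ ik.
have k0E p : (0 <= (EFin \o k) p)%E by rewrite lee_fin.
pose K y := (\int[mu]_x (k (x, y))%:E)%E.
have K0 y : (0 <= K y)%E by apply: integral_ge0 => x _; rewrite lee_fin.
have mK : measurable_fun setT K.
  exact: (measurable_fun_fubini_tonelli_G (m1 := mu) (EFin \o k)).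
have intK : (\int[mu]_y `|K y| = 0)%E.
  under eq_integral do rewrite gee0_abs//.
  rewrite -[RHS]k0 (fubini_tonelli1 (m1 := mu) (m2 := mu) (EFin \o k) mk k0E).
  by rewrite -(fubini_tonelli (m1 := mu) (m2 := mu) (EFin \o k) mk k0E).
have [N [mN N0 KN]] := (ae_eq_integral_abs mu measurableT mK).1 intK.
exists N; split => // y /= Gy; apply: KN => /=; apply/not_implyP; split => // Ky0.
have {}Gy : 0 < G y by rewrite lt_def G_ge0 andbT; apply/eqP.
have mky : measurable_fun setT (fun x => (k (x, y))%:E).
  exact: (measurableT_comp mk (measurable_pair2 y)).
have Ky : (\int[mu]_x `|(k (x, y))%:E| = 0)%E.
  by rewrite -[RHS]Ky0; apply: eq_integral => x _; rewrite gee0_abs// lee_fin.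
have [N' [mN' N'0 kN']] := (ae_eq_integral_abs mu measurableT mky).1 Ky.
have /negP := lebesgue_tuple_exterior (expR 1 * enorm y); apply; apply/eqP.
apply: (subset_measure0 (measurable_exterior _) mN' _ N'0) => x /= xy.
apply: kN' => /=; apply/not_implyP; split => //; apply/eqP.
have x0 : 0 < enorm x by apply: le_lt_trans xy; rewrite mulr_ge0 ?expR_ge0 ?enorm_ge0.
rewrite eqe /k indicE mem_set// mulr1 mulf_neq0// gt_eqF//.
exact: W_gt0.
Qed.

(** A density for which the form is o(h) vanishes, since the form is bounded below
by a multiple of h. *)
Lemma pairing_small_eq0 (e : R^nat) : (forall r, 0 < r -> 0 < W r) ->
  e j @[j --> \oo] --> 0 ->
  (forall j, pairing w G j.+1%:R^-1 <= j.+1%:R^-1 * e j) ->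
  {ae mu, forall y, G y = 0}.
Proof.
move=> W_gt0 e0 Ge; apply: pairing_rigidity => //.
have le_e j : 2^-1 * \int[P]_p k p <= e j.
  have j0 : 0 < j.+1%:R^-1 :> R by rewrite invr_gt0.
  rewrite -(ler_pM2l j0) mulrA; apply: le_trans (Ge j); apply: pairing_lower.
  by rewrite ltW//= invf_le1// ler1n.
rewrite -(@pmulr_rle0 _ 2^-1)//.
rewrite -(cvg_lim _ e0)//; apply: limr_ge; first by apply/cvg_ex; exists 0.
exact: nearW.
Qed.

End radial_weight.
End pairing_rigidity.

(** * The dilation inequality *)

Section dilation.
Context {R : realType} (m : nat).
Local Notation n := m.+2.
Local Notation mu := (lebesgue_tuple R n).
Implicit Types (x y : n.-tuple R) (h r : R).

Variables (alpha g : R) (v : R -> R) (F : n.-tuple R -> R).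
Hypothesis mv : measurable_fun setT v.
Hypothesis F_ge0 : forall y, 0 <= F y.
Hypothesis iF : mu.-integrable setT (EFin \o F).
Hypothesis g_gt0 : 0 < g.

Let W r := r `^ (n%:R * alpha) * expR (n%:R * v r).
Let w x := W (enorm x).
Hypothesis iw : mu.-integrable setT (EFin \o w).
Let D h r := v (expR (- h) * r) - v r.
Hypothesis DE : forall h r, 0 <= r ->
  D h r = g^-1 * \int[mu]_y (F y * log_mean_diff h r (enorm y) (planar_ratio y)).

Let iFd h r : 0 <= r ->
  mu.-integrable setT (fun y => (F y * log_mean_diff h r (enorm y) (planar_ratio y))%:E).
Proof.
move=> r0; apply: (@integrable_mul_bounded _ _ _ _ _ _ `|h|) => //.
- apply: measurable_log_mean_diff => //; first exact: measurable_enorm.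
  exact: measurable_planar_ratio.
- by move=> y; apply: norm_log_mean_diff; rewrite ?enorm_ge0 ?planar_ratio01.
Qed.

Let D_bound h r : 0 <= r -> `|D h r| <= g^-1 * (`|h| * \int[mu]_y F y).
Proof.
move=> r0; rewrite DE// normrM ger0_norm ?invr_ge0 ?(ltW g_gt0)//.
rewrite ler_pM2l ?invr_gt0//.
apply: le_trans (le_normr_Rintegral measurableT (iFd h r0)) _.
rewrite -RintegralZl//; apply: le_Rintegral => //.
- exact: (integrable_norm (iFd h r0)).
- exact: (integrableZl measurableT `|h| iF).
move=> y _; rewrite normrM ger0_norm// mulrC ler_wpM2r//.
by apply: norm_log_mean_diff; rewrite ?enorm_ge0 ?planar_ratio01.
Qed.

Let mDx h : measurable_fun setT (fun x => D h (enorm x)).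
Proof.
have mvs (s : R) : measurable_fun [set: n.-tuple R] (fun x => v (s * enorm x)).
  apply: (measurableT_comp mv); apply: measurable_funM => //.
  exact: measurable_enorm.
apply: measurable_funB; first exact: mvs.
exact: (measurableT_comp mv (@measurable_enorm R n)).
Qed.

Let iwD h : mu.-integrable setT (fun x => (w x * D h (enorm x))%:E).
Proof.
by apply: (integrable_mul_bounded iw (mDx h)) => x; apply: D_bound; exact: enorm_ge0.
Qed.

Let w_ge0 x : 0 <= w x.
Proof. by rewrite mulr_ge0 ?powR_ge0 ?expR_ge0. Qed.

Let mw : measurable_fun setT w.
Proof. by apply/measurable_EFinP; exact: measurable_int iw. Qed.

Let w_scale h x : w (tuple_scale (expR (- h)) x) =
  w x * expR (n%:R * (D h (enorm x) - alpha * h)).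
Proof.
rewrite /w /W enorm_scale ?expR_ge0// powRM ?expR_ge0 ?enorm_ge0//.
have E : expR (- h) `^ (n%:R * alpha) * expR (n%:R * v (expR (- h) * enorm x)) =
    expR (n%:R * v (enorm x)) * expR (n%:R * (D h (enorm x) - alpha * h)).
  by rewrite -expRM -!expRD; congr expR; rewrite /D; ring.
by rewrite -[RHS]mulrA -E; ring.
Qed.

(** The substitution x -> e^(-h) x does not change the mass of w up to the
Jacobian, so the integral of w e^(n (D h - (1 + alpha) h)) equals the integral
of w. The inequality e^z >= 1 + z linearises this identity; no derivative of v
and no boundary term are needed, and h may have either sign. *)
Lemma dilation_le h :
  \int[mu]_x (w x * D h (enorm x)) <= (1 + alpha) * h * \int[mu]_x w x.
Proof.
have s0 := expR_gt0 (- h).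
pose z x := w x * expR (n%:R * (D h (enorm x) - (1 + alpha) * h)).
have z0 x : 0 <= z x by rewrite mulr_ge0 ?expR_ge0.
have mz : measurable_fun setT z.
  apply: measurable_funM => //.
  apply: (@measurableT_comp _ _ _ _ _ _ (@expR R) _
    (fun x => n%:R * (D h (enorm x) - (1 + alpha) * h))) => //.
  by apply: measurable_funM => //; exact: measurable_funB.
have intz : (\int[mu]_x (z x)%:E = \int[mu]_x (w x)%:E)%E.
  have := @ge0_integral_tuple_scale R n _ (EFin \o w) s0
    (measurable_int _ iw) (fun x => w_ge0 x).
  under eq_integral do rewrite /= w_scale.
  move=> H.
  have -> : (\int[mu]_x (z x)%:E = (expR (- h) ^+ n)%:E *
      \int[mu]_x (w x * expR (n%:R * (D h (enorm x) - alpha * h)))%:E)%E.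
    rewrite -ge0_integralZl_EFin; first last.
    - exact: exprn_ge0 (ltW s0).
    - apply/measurable_EFinP; apply: measurable_funM => //.
      apply: (@measurableT_comp _ _ _ _ _ _ (@expR R) _
        (fun x => n%:R * (D h (enorm x) - alpha * h))) => //.
      by apply: measurable_funM => //; exact: measurable_funB.
    - by move=> x _; rewrite lee_fin mulr_ge0 ?expR_ge0.
    - exact: measurableT.
    apply: eq_integral => x _; rewrite -EFinM; congr (_%:E).
    rewrite /z -expRM_natl mulrCA -expRD; congr (_ * expR _); ring.
  by rewrite H muleA -EFinM divff ?mul1e// expf_neq0// gt_eqF.
have iz : mu.-integrable setT (EFin \o z).
  apply/integrableP; split; first exact/measurable_EFinP.
  rewrite (_ : (\int[_]_x _)%E = (\int[mu]_x (w x)%:E)%E); last first.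
    by rewrite -intz; apply: eq_integral => x _ /=; rewrite ger0_norm.
  by have := integrable_fin_num measurableT iw; rewrite fin_numElt => /andP[].
have i1 := integrableZl measurableT n%:R (iwD h).
have i2 := integrableZl measurableT (1 - n%:R * ((1 + alpha) * h)) iw.
have : \int[mu]_x ((1 - n%:R * ((1 + alpha) * h)) * w x + n%:R * (w x * D h (enorm x)))
       <= \int[mu]_x z x.
  apply: (le_Rintegral measurableT (integrableD measurableT i2 i1) iz).
  move=> x _; have := expR_ge1Dx (n%:R * (D h (enorm x) - (1 + alpha) * h)).
  move=> /(ler_wpM2l (w_ge0 x)); rewrite -/(z x); apply: le_trans.
  by rewrite le_eqVlt; apply/orP; left; apply/eqP; ring.
rewrite (RintegralD measurableT i2 i1) !RintegralZl//; last exact: iwD.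
have -> : \int[mu]_x z x = \int[mu]_x w x by rewrite /Rintegral intz.
have n0 : 0 < n%:R :> R by rewrite ltr0n.
move: (\int[mu]_x w x) (\int[mu]_x (w x * D h (enorm x))) (n%:R : R) n0.
by move=> L I N N0 H; rewrite -(ler_pM2l N0); lra.
Qed.

Lemma pairing_le h : pairing w F h <= g * ((1 + alpha) * h * \int[mu]_x w x).
Proof.
apply: le_trans (ler_wpM2l (ltW g_gt0) (dilation_le h)).
rewrite -RintegralZl//; last exact: iwD.
rewrite le_eqVlt; apply/orP; left; apply/eqP; apply: EFin_inj.
rewrite -(pairing_fubini h iw iF).
rewrite [RHS]fineK; last first.
  exact: (integrable_fin_num measurableT (integrableZl measurableT g (iwD h))).
apply: eq_integral => x _.
under eq_integral do rewrite -mulrA EFinM.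
rewrite integralZl//; last exact: (iFd h (enorm_ge0 x)).
rewrite (DE h (enorm_ge0 x)) (_ : g * _ = w x * (g * g^-1) *
  \int[mu]_y (F y * log_mean_diff h (enorm x) (enorm y) (planar_ratio y))); last ring.
rewrite divff ?gt_eqF// mulr1 [RHS]EFinM; congr (_ * _)%E; rewrite [RHS]fineK//.
exact: (integrable_fin_num measurableT (iFd h (enorm_ge0 x))).
Qed.

End dilation.

(** * From the form to the mass *)

Section mass.
Context {R : realType} (m : nat).
Local Notation n := m.+2.
Local Notation mu := (lebesgue_tuple R n).
Implicit Types (x y : n.-tuple R) (h r : R).

Variables (W : R -> R) (K : R).
Hypothesis mW : measurable_fun setT W.
Hypothesis W_ge0 : forall r, 0 <= W r.
Hypothesis W_gt0 : forall r, 0 < r -> 0 < W r.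
Let w x := W (enorm x).
Hypothesis iw : mu.-integrable setT (EFin \o w).
Let L := \int[mu]_x w x.

Let L_ge0 : 0 <= L.
Proof. by apply: Rintegral_ge0 => x _; exact: W_ge0. Qed.

Let hs (j : nat) : R := j.+1%:R^-1.

Let hs_gt0 j : 0 < hs j.
Proof. by rewrite invr_gt0. Qed.

Let hs_cvg : hs j @[j --> \oo] --> (0 : R).
Proof. exact: cvg_harmonic. Qed.

Let quotient_cvg : pairing w w (hs j) / hs j @[j --> \oo] --> L ^+ 2 / 2.
Proof. by apply: (pairing_cvg mW W_ge0 iw _ hs_cvg) => j; rewrite gt_eqF. Qed.

Lemma mass_gt0 : 0 < L.
Proof.
rewrite lt_def L_ge0 andbT; apply/eqP => L0.
have mw := measurable_int _ iw.
have intw : (\int[mu]_x `|(w x)%:E| = 0)%E.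
  under eq_integral => x _ do rewrite gee0_abs ?lee_fin ?W_ge0//.
  by rewrite -(fineK (integrable_fin_num measurableT iw)) [fine _]L0.
have [N [mN N0 wN]] := (ae_eq_integral_abs mu measurableT mw).1 intw.
have /negP := @lebesgue_tuple_exterior R m 0; apply; apply/eqP.
apply: (subset_measure0 (measurable_exterior _) mN _ N0) => x /= x0.
apply: wN => /=; apply/not_implyP; split => //; apply/eqP.
by rewrite eqe gt_eqF// W_gt0.
Qed.

(** Divide by h > 0 and let h tend to 0, using pairing_cvg. *)
Lemma mass_le : (forall h, 0 <= h -> pairing w w h <= h * (K * L)) -> L <= 2 * K.
Proof.
move=> wK; have : L ^+ 2 / 2 <= K * L.
  rewrite -(cvg_lim _ quotient_cvg)//; apply: limr_le.
    by apply/cvg_ex; exists (L ^+ 2 / 2).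
  by apply: nearW => j; rewrite ler_pdivrMr// mulrC; apply: wK; exact: ltW.
rewrite ler_pdivrMr// expr2 mulrAC ler_pM2r ?mass_gt0//.
by rewrite mulrC.
Qed.

(** The same limit with h < 0. *)
Lemma mass_ge : (forall h, h <= 0 -> pairing w w h <= h * (K * L)) -> 2 * K <= L.
Proof.
move=> wK; have : K * L <= L ^+ 2 / 2.
  have N_cvg : - hs j @[j --> \oo] --> (0 : R).
    by rewrite -[X in _ --> X]oppr0; apply: cvgN.
  have N_neq0 j : - hs j != 0 by rewrite oppr_eq0 gt_eqF.
  have q_cvg := pairing_cvg mW W_ge0 iw N_neq0 N_cvg.
  rewrite -(cvg_lim _ q_cvg)//; apply: limr_ge.
    by apply/cvg_ex; exists (L ^+ 2 / 2).
  apply: nearW => j; rewrite ler_ndivlMr ?oppr_lt0// mulrC; apply: wK.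
  by rewrite oppr_le0 ltW.
rewrite ler_pdivlMr// expr2 mulrAC ler_pM2r ?mass_gt0//.
by rewrite mulrC.
Qed.

(** When the mass has the extremal value, both the form of w with w and the form
of w with F are h L^2 / 2 up to o(h), so the form of w with F - w is o(h). *)
Lemma mass_eq_rigidity (F : n.-tuple R -> R) : (forall x, w x <= F x) ->
  mu.-integrable setT (EFin \o F) ->
  (forall h, 0 <= h -> pairing w F h <= h * (K * L)) -> L = 2 * K ->
  {ae mu, forall y, F y = w y}.
Proof.
move=> wF iF FK LK.
pose G y := F y - w y.
have iG : mu.-integrable setT (EFin \o G) by exact: (integrableB measurableT iF iw).
have G0 y : 0 <= G y by rewrite subr_ge0.
pose e j := L ^+ 2 / 2 - pairing w w (hs j) / hs j.
have e_cvg : e j @[j --> \oo] --> (0 : R).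
  by rewrite -[X in _ --> X](subrr (L ^+ 2 / 2)); apply: cvgB; [exact: cvg_cst|exact: quotient_cvg].
have Ge j : pairing w G (hs j) <= hs j * e j.
  have -> : pairing w G (hs j) = pairing w F (hs j) - pairing w w (hs j).
    rewrite /pairing -(RintegralB measurableT (integrable_pairing (hs j) iw iF)
      (integrable_pairing (hs j) iw iw)).
    by rewrite /Rintegral; congr fine; apply: eq_integral => p _; congr (_%:E); rewrite /G; ring.
  have -> : hs j * e j = hs j * (L ^+ 2 / 2) - pairing w w (hs j).
    by rewrite /e mulrBr; congr (_ - _); rewrite mulrC divfK// gt_eqF.
  rewrite lerD2r.
  apply: le_trans (FK _ (ltW (hs_gt0 j))) _.
  by rewrite ler_pM2l// expr2 {2}LK; lra.
have := pairing_small_eq0 W_ge0 iw G0 iG W_gt0 e_cvg Ge.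
by apply: filterS => y; rewrite /G => /eqP; rewrite subr_eq0 => /eqP.
Qed.

(** The increments are nonnegative for h >= 0: this is where the monotonicity of
the circular means enters. *)
Lemma le_pairing (F : n.-tuple R -> R) h : (forall x, w x <= F x) ->
  mu.-integrable setT (EFin \o F) -> 0 <= h -> pairing w w h <= pairing w F h.
Proof.
move=> wF iF h0.
apply: (le_Rintegral measurableT (integrable_pairing h iw iw) (integrable_pairing h iw iF)).
move=> p _; rewrite ler_wpM2r//.
  have /andP[] // := log_mean_diff_ge0 h0 (enorm_ge0 p.1) (enorm_ge0 p.2) (planar_ratio01 p.2).
by rewrite ler_wpM2l// W_ge0.
Qed.

End mass.

(** * Radial normal solutions *)

Lemma ae_eq_integrable d (T : measurableType d) (R : realType)
    (mu : {measure set T -> \bar R}) (f g : T -> R) :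
  measurable_fun setT g -> {ae mu, forall x, f x = g x} ->
  mu.-integrable setT (EFin \o f) -> mu.-integrable setT (EFin \o g).
Proof.
move=> mg fg /integrableP[mf foo].
have mge : measurable_fun setT (EFin \o g) by exact/measurable_EFinP.
apply/integrableP; split => //; move: foo; congr (_ < _)%E.
apply: ge0_ae_eq_integral => //; try exact: measurableT_comp.
by apply: filterS fg => x /= -> _.
Qed.

Section normal_solution_theory.
Context {R : realType} (m : nat).
Local Notation n := m.+2.
Local Notation mu := (lebesgue_tuple R n).
Implicit Types (x y : n.-tuple R) (h r : R).

Variables (f u : n.-tuple R -> R) (v : R -> R) (g c : R).
Hypothesis g_gt0 : 0 < g.
Hypothesis intf : mu.-integrable setT (EFin \o f).
Hypothesis ikf : forall x, mu.-integrable setT (fun y => (log_kernel x y * f y)%:E).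
Hypothesis uE : forall x, u x = g^-1 * (\int[mu]_y (log_kernel x y * f y)) + c.
Hypothesis uv : forall x, u x = v (enorm x).

(** u is constant on great circles, so v is the potential of F for the mean
kernel. *)
Lemma radial_increment (F : n.-tuple R -> R) : (forall y, 0 <= F y) ->
  measurable_fun setT F -> {ae mu, forall y, f y = F y} ->
  forall h r, 0 <= r -> v (expR (- h) * r) - v r =
    g^-1 * \int[mu]_y (F y * log_mean_diff h r (enorm y) (planar_ratio y)).
Proof.
move=> F0 mF fF h r; rewrite le_eqVlt => /predU1P[<-|r0].
  rewrite mulr0 subrr (_ : Rintegral _ _ _ = 0) ?mulr0//.
  rewrite /Rintegral (_ : (\int[_]_y _)%E = 0%E)//.
  by apply: integral0_eq => y _; rewrite log_mean_diff0 mulr0.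
have iF : mu.-integrable setT (EFin \o F) by exact: ae_eq_integrable intf.
have mlk x : measurable_fun setT (fun y => log_kernel x y).
  exact: measurable_log_kernel_comp.
have kfF x : {ae mu, forall y, log_kernel x y * f y = log_kernel x y * F y}.
  by apply: filterS fF => y ->.
have mkF x : measurable_fun setT (fun y => log_kernel x y * F y) by exact: measurable_funM.
have ikF x : mu.-integrable setT (fun y => (log_kernel x y * F y)%:E).
  exact: (ae_eq_integrable (mkF x) (kfF x) (ikf x)).
have potential s : 0 < s ->
    mu.-integrable setT (fun y => (mean_kernel s y * F y)%:E) /\
    \int[mu]_y (mean_kernel s y * F y) = g * (v s - c).
  move=> s0; apply: great_circle_potential => // t.
  have -> : v s = u (great_circle m s t) by rewrite uv enorm_great_circle// ltW.
  rewrite uE addrK mulrA divff ?mul1r ?gt_eqF// /Rintegral; congr fine.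
  apply: ae_eq_integral => //.
  - by apply/measurable_EFinP; exact: mkF.
  - exact: (measurable_int _ (ikf _)).
  - by apply: filterS (kfF (great_circle m s t)) => y /= -> _.
have er0 : 0 < expR (- h) * r by rewrite mulr_gt0// expR_gt0.
have [i1 E1] := potential _ r0; have [i2 E2] := potential _ er0.
transitivity (g^-1 * (g * (v (expR (- h) * r) - c) - g * (v r - c))).
  by rewrite -mulrBr mulrA mulVf ?mul1r ?gt_eqF//; ring.
rewrite -E1 -E2 -(RintegralB measurableT i2 i1); congr (_ * _).
rewrite /Rintegral; congr fine; apply: eq_integral => y _; congr (_%:E).
by rewrite /mean_kernel /log_mean_diff; ring.
Qed.

(** By radial_increment v is nonincreasing on the positive half-line. The absolute
value gives a function on the whole line that is determined by u. *)
Lemma measurable_radial_profile : {ae mu, forall y, f y = `|f y|} ->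
  measurable_fun setT (fun r => v `|r|).
Proof.
move=> fF.
have mf : measurable_fun setT f by apply/measurable_EFinP; exact: measurable_int intf.
have incr := radial_increment (fun y => normr_ge0 (f y))
  (measurableT_comp (@normr_measurable R setT) mf) fF.
(* a global monotone function of the logarithm of the radius *)
have vexp_ni : {homo (v \o expR) : s t / s <= t >-> t <= s}.
  move=> s t st /=; rewrite -subr_ge0.
  have -> : expR s = expR (- (t - s)) * expR t by rewrite -expRD; congr expR; ring.
  rewrite incr ?expR_ge0// mulr_ge0 ?invr_ge0 ?(ltW g_gt0)//.
  apply: Rintegral_ge0 => y _; rewrite mulr_ge0//.
  have ts : 0 <= t - s by rewrite subr_ge0.
  by have /andP[] := log_mean_diff_ge0 ts (expR_ge0 t) (enorm_ge0 y) (planar_ratio01 y).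
have mvexp : measurable_fun setT (v \o expR).
  exact: nonincreasing_measurable.
have -> : (fun r => v `|r|) = fun r => if r == 0 then v 0 else (v \o expR) (ln `|r|).
  apply/funext => r; case: eqVneq => [->|r0]; first by rewrite normr0.
  by rewrite /= lnK// posrE normr_gt0.
apply: measurable_fun_if => //.
- exact: measurable_fun_eqr.
- apply: measurable_funTS; apply: (measurableT_comp mvexp).
  by apply: (@measurableT_comp _ _ _ _ _ _ (@ln R) _ (fun r : R => `|r|)).
Qed.

End normal_solution_theory.

Theorem theorem1p3 (R : realType) (n : nat) (alpha : R) (Q u : n.-tuple R -> R) :
  (2 <= n)%N ->
  -1 < alpha ->
  locally_Linfty Q ->
  radial u ->
  normal_solution alpha Q u ->
  let mu := lebesgue_tuple R n in
  (\int[mu]_x (enorm x `^ (n%:R * alpha) * `|Q x| * expR (n%:R * u x))%:E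
     < +oo)%E ->
  let Lambda :=
    (\int[mu]_x (enorm x `^ (n%:R * alpha) * expR (n%:R * u x))%:E)%E in
  {ae mu, forall x, 1 <= Q x} ->
  (Lambda <= (Lambda1 R n * (1 + alpha))%:E)%E /\
  (Lambda = (Lambda1 R n * (1 + alpha))%:E <-> {ae mu, forall x, Q x = 1}).
Proof.
case: n Q u => [|[|m]]// Q u _ alpha1 _ [v0 uv0] [intf [c ikf]] mu _ Lambda Q1.
pose n := m.+2.
pose f (y : n.-tuple R) := enorm y `^ (n%:R * alpha) * Q y * expR (n%:R * u y).
have mf : measurable_fun setT f by apply/measurable_EFinP; exact: measurable_int intf.
pose v (r : R) : R := v0 `|r|.
have uv x : u x = v (enorm x) by rewrite /v ger0_norm ?enorm_ge0.
pose g := gamma_ R n; have g0 : 0 < g := @gamma_gt0 R n.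
have ikf1 x : mu.-integrable setT (fun y => (log_kernel x y * f y)%:E) := (ikf x).1.
have uE x : u x = g^-1 * (\int[mu]_y (log_kernel x y * f y)) + c := (ikf x).2.
have fF : {ae mu, forall y, f y = `|f y|}.
  apply: filterS Q1 => y Qy; rewrite ger0_norm// !mulr_ge0 ?powR_ge0 ?expR_ge0//.
  exact: le_trans Qy.
have mv : measurable_fun setT v.
  exact: (measurable_radial_profile g0 intf ikf1 uE uv0 fF).
pose W (r : R) : R := r `^ (n%:R * alpha) * expR (n%:R * v r).
pose w (y : n.-tuple R) := W (enorm y).
have W_ge0 r : 0 <= W r by rewrite mulr_ge0 ?powR_ge0 ?expR_ge0.
have W_gt0 r : 0 < r -> 0 < W r by move=> r0; rewrite mulr_gt0 ?powR_gt0 ?expR_gt0.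
have mW : measurable_fun setT W.
  apply: measurable_funM; first exact: measurable_powR.
  apply: (@measurableT_comp _ _ _ _ _ _ (@expR R) _ (fun r => n%:R * v r)) => //.
  exact: measurable_funM.
have mw : measurable_fun setT w := measurableT_comp mW (@measurable_enorm R n).
have fw y : f y = w y * Q y by rewrite /f /w /W -uv; ring.
have LE : Lambda = (\int[mu]_y (w y)%:E)%E.
  by apply: eq_integral => y _; rewrite /w /W -uv.
(* f is changed on a null set so as to dominate w at every point *)
pose F y := Num.max `|f y| (w y).
have mF : measurable_fun setT F by apply: measurable_maxr => //; exact: measurableT_comp.
have wF y : w y <= F y by rewrite /F le_max lexx orbT.
have F0 y : 0 <= F y by apply: le_trans (wF y); exact: W_ge0.
have fFae : {ae mu, forall y, f y = F y}.
  apply: filterS2 fF Q1 => y fy Qy; rewrite /F -fy max_l// fw ler_peMr//.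
  exact: W_ge0.
have iF : mu.-integrable setT (EFin \o F) := ae_eq_integrable mF fFae intf.
have iw : mu.-integrable setT (EFin \o w).
  apply: le_integrable iF => //; first exact/measurable_EFinP.
  by move=> y _; rewrite /= lee_fin !ger0_norm//; exact: W_ge0.
pose L := \int[mu]_y w y.
have LambdaE : Lambda = L%:E by rewrite LE /L /Rintegral fineK//; exact: integrable_fin_num iw.
pose K := g * (1 + alpha).
have a0 : 0 < 1 + alpha by lra.
have K0 : 0 < K by rewrite mulr_gt0.
have Lambda1E : Lambda1 R n * (1 + alpha) = 2 * K by rewrite /Lambda1 -/g /K; ring.
have FK h : pairing w F h <= h * (K * L).
  have DE := radial_increment g0 intf ikf1 uE uv F0 mF fFae.
  have -> : h * (K * L) = g * ((1 + alpha) * h * L) by rewrite /K; ring.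
  exact: (pairing_le mv F0 iF g0 iw DE h).
have L_le : L <= 2 * K.
  apply: (mass_le mW W_ge0 W_gt0 iw) => h h0.
  exact: le_trans (le_pairing W_ge0 iw wF iF h0) (FK h).
rewrite LambdaE Lambda1E lee_fin; split=> //; split=> [[LK]|Qeq1].
  have Fw := mass_eq_rigidity mW W_ge0 W_gt0 iw wF iF (fun h _ => FK h) LK.
  have y0 : {ae mu, forall y, 0 < enorm y}.
    exists [set y | enorm y = 0]; split.
    - exact: (measurable_preimage_enorm (A := [set 0])).
    - exact: lebesgue_tuple_sphere.
    by move=> y /= /negP; rewrite lt_def enorm_ge0 andbT negbK => /eqP.
  apply: filterS3 Fw fFae y0 => y Fy fy y0.
  have wy : w y != 0 by rewrite gt_eqF// W_gt0.
  by apply: (mulfI wy); rewrite mulr1 -fw fy.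
(* if Q = 1 almost everywhere then w is itself a density of u, and the dilation
   inequality for h < 0 bounds the mass from below *)
congr (_%:E); apply/eqP; rewrite eq_le L_le/=.
have fw1 : {ae mu, forall y, f y = w y}.
  by apply: filterS Qeq1 => y Qy; rewrite fw Qy mulr1.
have DE := radial_increment g0 intf ikf1 uE uv (fun y => W_ge0 _) mw fw1.
apply: (mass_ge mW W_ge0 W_gt0 iw) => h _.
have -> : h * (K * L) = g * ((1 + alpha) * h * L) by rewrite /K; ring.
exact: (pairing_le mv (fun y => W_ge0 _) iw g0 iw DE h).
Qed.
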